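(* Let $(A,\varphi)$ be a non-commutative probability space over a field $\mathbb{K}$ of characteristic zero, with monotone cumulants $\rho$ and free cumulants $\kappa$ (regarded as linear forms on $T_+(A)$). Then for every $m\ge 1$ and all $a_1,\dots,a_m\in A$, $$\rho(a_1\cdots a_m)=\sum_{\pi\in \mathrm{NC}^{\mathrm{irr}}(m)}(-1)^{|\pi|-1}\,\omega(\pi)\prod_{\pi_i\in\pi}\kappa(a_{\pi_i}),$$ where $\omega(\pi)$ (which depends only on the rooted tree $t(\pi)$ encoding the nesting of the blocks of $\pi$, and is also denoted $\omega(t(\pi))$) is the rational number $$\omega(\pi)=\sum_{k=1}^{m}\frac{(-1)^{k+1}}{k}\,\omega_k(\pi).$$
   Context: A non-commutative probability space $(A,\varphi)$ is a unital associative algebra $A$ over a field $\mathbb{K}$ of characteristic zero together with a linear map $\varphi\colon A\to\mathbb{K}$ with $\varphi(1_A)=1$ (no positivity is assumed). $T_+(A)=\bigoplus_{n>0}A^{\otimes n}$; the element $a_1\otimes\cdots\otimes a_n$ is written as a word $a_1\cdots a_n$. For a nonempty subset $S=\{i_1<\dots<i_r\}\subseteq[n]=\{1,\dots,n\}$, $a_S$ denotes the word $a_{i_1}\cdots a_{i_r}\in T_+(A)$. The moment functional is the linear form $\phi$ on $T_+(A)$ with $\phi(a_1\cdots a_n)=\varphi(a_1\cdot_A\cdots\cdot_A a_n)$, where $\cdot_A$ is the product of $A$. $\mathrm{NC}(n)$ is the set of non-crossing partitions of $[n]$; $|\pi|$ is the number of blocks of $\pi$. $\mathrm{NC}^{\mathrm{irr}}(n)$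 is the subset of irreducible ones, i.e. those for which $1$ and $n$ lie in the same block. The blocks of $\pi\in\mathrm{NC}(n)$ are partially ordered by nesting: $\pi_j<\pi_i$ if and only if there exist $x,y\in\pi_j$ such that $x<z<y$ for every $z\in\pi_i$. The Hasse diagram of this order is a rooted forest $t(\pi)$ whose vertices are the blocks and whose roots are the outer (minimal) blocks; it is a tree when $\pi$ is irreducible. The tree factorial is defined inductively by $\bullet!=1$ for the one-vertex tree and $t!=|t|\,t_1!\cdots t_r!$ if $t$ is obtained by attaching the trees $t_1,\dots,t_r$ to a new common root, $|t|$ being the number of vertices; the factorial of a forest is the product of the factorials of its trees. The monotone cumulants $\rho$ and free cumulants $\kappa$ are the linear forms on $T_+(A)$ uniquely determined by the moment-cumulant relations, for all $n\geq 1$ and $a_1,\dots,a_n\in A$: $$\phi(a_1\cdots a_n)=\sum_{\pi\in\mathrm{NC}(n)}\frac{1}{t(\pi)!}\prod_{\pi_i\in\pi}\rho(a_{\pi_i}),\qquad \phi(a_1\cdots a_n)=\sum_{\pi\in\mathrm{NC}(n)}\prod_{\pi_i\in\pi}\kappa(a_{\pi_i}).$$ For $\pi\in\mathrm{NC}^{\mathrm{irr}}(m)$ and $k\ge1$, $\omega_k(\pi)$ is the number of total quasi-orders $\preceq$ (reflexive, transitive relations in which any two elements are comparable) on the set of blocks of $\pi$ having exactly $k$ equivalence classes and such that $\pi_i<\pi_j$ implies $\pi_i\prec\pi_j$ (that is, $\pi_i\preceq\pi_j$ and not $\pi_j\preceq\pi_i$). Equivalently, $\omega_k(\pi)$ is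 the number of surjective maps $f$ from the set of blocks of $\pi$ onto $\{1,\dots,k\}$ such that $\pi_i<\pi_j$ implies $f(\pi_i)<f(\pi_j)$. *)

(* Defs.v *)
From HB Require Import structures.
From mathcomp Require Import all_boot all_order all_algebra.

Set Implicit Arguments.
Unset Strict Implicit.
Unset Printing Implicit Defensive.

Import GRing.Theory.
Local Open Scope ring_scope.

Definition noncrossing (n : nat) (P : {set {set 'I_n}}) : bool :=
  [forall B in P, forall C in P, (B != C) ==>
    ~~ [exists i in B, exists j in C, exists k in B, exists l in C,
          [&& i < j, j < k & k < l]%N]].

Definition NC (n : nat) : {set {set {set 'I_n}}} :=
  [set P | partition P [set: 'I_n] & noncrossing P].

(* [n] is encoded as 'I_n, so the points 1 and n are the ordinals 0 and n - 1. *)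
Definition irreducible_partition (n : nat) (P : {set {set 'I_n}}) : bool :=
  [exists B in P, exists i in B, exists j in B,
     (val i == 0%N) && ((val j).+1 == n)].

Definition NCirr (n : nat) : {set {set {set 'I_n}}} :=
  [set P in NC n | irreducible_partition P].

(* B < C in the nesting order, whose minimal elements are the outer blocks. *)
Definition nested (n : nat) (B C : {set 'I_n}) : bool :=
  [exists x in B, exists y in B, forall z in C, (x < z < y)%N].

(* The edges, oriented away from the roots, of the Hasse diagram of P. *)
Definition covers (n : nat) (P : {set {set 'I_n}}) (B C : {set 'I_n}) : bool :=
  nested B C && ~~ [exists D in P, nested B D && nested D C].

Definition outer (n : nat) (P : {set {set 'I_n}}) (B : {set 'I_n}) : bool :=
  ~~ [exists D in P, nested D B].

Inductive rtree : Type := Node of seq rtree.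

Fixpoint tree_size (t : rtree) : nat :=
  let: Node ts := t in (\sum_(k <- [seq tree_size u | u <- ts]) k).+1%N.

Fixpoint tree_fact (t : rtree) : nat :=
  let: Node ts := t in
  (tree_size t * \prod_(k <- [seq tree_fact u | u <- ts]) k)%N.

Definition forest_fact (f : seq rtree) : nat := (\prod_(t <- f) tree_fact t)%N.

(* The tree above the block B, cut at height [fuel]. A chain of blocks of P
   has at most #|P| elements, so nothing is cut when fuel = #|P|. The order
   in which children are listed is irrelevant to [tree_fact]. *)
Fixpoint block_tree (n : nat) (P : {set {set 'I_n}}) (fuel : nat)
    (B : {set 'I_n}) : rtree :=
  if fuel is fuel'.+1 then
    Node [seq block_tree P fuel' C | C <- enum [set C in P | covers P B C]]
  else Node [::].

Definition nesting_forest (n : nat) (P : {set {set 'I_n}}) : seq rtree :=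
  [seq block_tree P #|P| B | B <- enum [set B in P | outer P B]].

(* t(P) and t(Q) are isomorphic rooted forests: since edges are oriented away
   from the roots, preserving them also preserves the roots. *)
Definition same_nesting_forest (n n' : nat) (P : {set {set 'I_n}})
    (Q : {set {set 'I_n'}}) : Prop :=
  exists f : {set 'I_n} -> {set 'I_n'},
    [/\ {in P &, injective f}, f @: P = Q
      & {in P &, forall B C, covers Q (f B) (f C) = covers P B C}].

(* A quasi-order on the set of blocks P is given by its graph R. *)
Definition total_quasi_order (n : nat) (P : {set {set 'I_n}})
    (R : {set {set 'I_n} * {set 'I_n}}) : bool :=
  [&& R \subset setX P P,
      [forall B in P, (B, B) \in R],
      [forall B in P, forall C in P, forall D in P,
         ((B, C) \in R) && ((C, D) \in R) ==> ((B, D) \in R)]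
    & [forall B in P, forall C in P, ((B, C) \in R) || ((C, B) \in R)]].

Definition quasi_order_classes (n : nat) (P : {set {set 'I_n}})
    (R : {set {set 'I_n} * {set 'I_n}}) : {set {set {set 'I_n}}} :=
  equivalence_partition (fun B C => ((B, C) \in R) && ((C, B) \in R)) P.

Definition strictly_extends_nesting (n : nat) (P : {set {set 'I_n}})
    (R : {set {set 'I_n} * {set 'I_n}}) : bool :=
  [forall B in P, forall C in P,
     nested B C ==> ((B, C) \in R) && ((C, B) \notin R)].

Definition omega_ (k n : nat) (P : {set {set 'I_n}}) : nat :=
  #|[set R | [&& total_quasi_order P R, #|quasi_order_classes P R| == k
               & strictly_extends_nesting P R]]|.

Definition omega (n : nat) (P : {set {set 'I_n}}) : rat :=
  \sum_(1 <= k < n.+1) (-1) ^+ k.+1 / k%:R * (omega_ k P)%:R.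

(* By the universal property of tensor products, a linear form on T_+(A) is a
   function on nonempty words over A that is linear in each letter. Its value
   on the empty word is irrelevant. *)
Definition linear_form (K : fieldType) (A : algType K) (f : seq A -> K) : Prop :=
  forall (u v : seq A) (c : K) (x y : A),
    f (u ++ (c *: x + y) :: v) = c * f (u ++ x :: v) + f (u ++ y :: v).

(* The word a_S; [enum S] lists S in increasing order. *)
Definition subword (T : Type) (n : nat) (a : n.-tuple T) (S : {set 'I_n}) :
    seq T :=
  [seq tnth a i | i <- enum S].

Definition moment (K : fieldType) (A : algType K) (phi : {scalar A})
    (w : seq A) : K :=
  phi (\prod_(x <- w) x).

Definition monotone_cumulants (K : fieldType) (A : algType K)
    (phi : {scalar A}) (rho : seq A -> K) : Prop :=
  linear_form rho /\
  forall (n : nat) (a : n.-tuple A), (0 < n)%N ->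
    moment phi a =
      \sum_(P in NC n)
        (forest_fact (nesting_forest P))%:R^-1 * \prod_(B in P) rho (subword a B).

Definition free_cumulants (K : fieldType) (A : algType K)
    (phi : {scalar A}) (kappa : seq A -> K) : Prop :=
  linear_form kappa /\
  forall (n : nat) (a : n.-tuple A), (0 < n)%N ->
    moment phi a = \sum_(P in NC n) \prod_(B in P) kappa (subword a B).

(* Main.v *)
Require Import Defs.
From HB Require Import structures.
From mathcomp Require Import all_boot all_order all_algebra.

Set Implicit Arguments.
Unset Strict Implicit.
Unset Printing Implicit Defensive.

Import GRing.Theory.
Local Open Scope ring_scope.

(** Both moment-cumulant relations are embedded in a polynomial flow, and the
    two flows are compared.

    Give every non-crossing partition P a polynomial y_P in one variable x, and
    for a set X of points put Y(X) = sum over P in NC(X) of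
    y_P * prod_(B in P) k(B). On the monotone side y_P = x^|P| / t(P)! and
    k = - rho; on the free side y_P is the strict order polynomial of the
    nesting order of P, and k = - kappa. At x = -1 both sums become the moment
    ([hook_poly_atN1], [order_poly_atN1]), and at x = 0 both vanish when X is
    nonempty.

    Both families satisfy y_P' = sum_W e(W) y_(P - W), where W runs over the
    up-closed sets of blocks of P that have a least block.
    For the order polynomials, expand sum_k omega_k binom(x, k): differentiation
    is log(1 + Delta), so it removes the top j layers with weight (-1)^(j+1)/j,
    and the removed blocks W collect e(W) = omega(W) ([deriv_order_poly]).
    This is the linear coefficient of the order polynomial of W; order
    polynomials are multiplicative over unrelated parts and vanish at 0, so
    omega(W) = 0 unless W is a tree ([murua_nontree]). For x^|P| / t(P)!, the
    equation is the identity |F| / F! = sum of 1 / (F - l)! over the leaves l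
    of the forest F, whence e(W) = 1 if W is one block and 0 otherwise
    ([hook_weight_rem_leaf]).

    A pair (P, W) as above is the same thing as an interval I of X, an
    irreducible partition W of I and a non-crossing partition P - W of X - I
    ([sum_ncp_cut]). Hence Y(X)' = sum_I E(I) Y(X - I) with
    E(I) = sum over W in NCirr(I) of e(W) * prod_(B in W) k(B); this is
    - rho(I) on the monotone side and the sum over NCirr(I) with the
    coefficients omega on the free side. Such a system is determined by the
    values at -1: by induction on X, the difference of the two solutions at X
    is x times the difference of the two E(X), and it vanishes at -1
    ([interval_flow_unique]). So the two E agree, which is the formula.

    That omega depends on the tree only holds because omega_k counts
    layerings ([omega_layerings]), a recursion on the nesting order, and this
    order is the transitive closure of its covering relation. *)

(** * Polynomials in characteristic zero *)

Section CharZero.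

Variables (K : fieldType) (charK : [pchar K] =i pred0).

Lemma natf_eq0 n : (n%:R == 0 :> K) = (n == 0%N).
Proof. by move/pcharf0P: charK. Qed.

Lemma natSf_neq0 n : n.+1%:R != 0 :> K.
Proof. by rewrite natf_eq0. Qed.

Lemma intf_eq0 (z : int) : (z%:~R == 0 :> K) = (z == 0).
Proof. by case: z => n; rewrite ?NegzE ?mulrNz ?oppr_eq0 natf_eq0. Qed.

Lemma ratr_frac (p q : int) : q != 0 -> ratr (p%:Q / q%:Q) = p%:~R / q%:~R :> K.
Proof.
move=> q0; set x := p%:Q / q%:Q; rewrite /ratr; apply/eqP.
rewrite eqr_div ?intf_eq0 ?denq_neq0 // -!intrM; apply/eqP; congr (_%:~R).
apply/eqP; rewrite -(eqr_int rat) !intrM.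
by rewrite numqE mulrAC /x divfK ?intr_eq0.
Qed.

(** Every partial sum equals a fraction a / b with the same integers a and b in
    both fields. *)
Lemma ratr_sum_frac (I : Type) (s : seq I) (p q : I -> int) :
  (forall i, q i != 0) ->
  ratr (\sum_(i <- s) (p i)%:Q / (q i)%:Q) = \sum_(i <- s) (p i)%:~R / (q i)%:~R :> K.
Proof.
move=> q0.
suff [a [b [b0 -> ->]]] : exists a b : int, [/\ b != 0,
    \sum_(i <- s) (p i)%:Q / (q i)%:Q = a%:Q / b%:Q &
    \sum_(i <- s) (p i)%:~R / (q i)%:~R = a%:~R / b%:~R :> K].
  exact: ratr_frac.
elim: s => [|i s [a [b [b0 IHQ IHK]]]].
  by exists 0, 1; rewrite !big_nil !mul0r.
exists (p i * b + a * q i), (q i * b); rewrite mulf_neq0 // !big_cons IHQ IHK.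
by rewrite !addf_div ?intf_eq0 ?intr_eq0 // !(intrM, intrD).
Qed.

Lemma deriv_inj0 (p : {poly K}) : p^`() = 0 -> p.[0] = 0 -> p = 0.
Proof.
move=> dp p0; apply/polyP => -[|i]; rewrite coef0; first by rewrite -horner_coef0.
have /eqP := congr1 (fun q : {poly K} => q`_i) dp.
by rewrite coef_deriv coef0 -mulr_natr mulf_eq0 natf_eq0 orbF => /eqP.
Qed.

(** Under these assumptions p = c * x, which vanishes at -1 only for c = 0. This
    is what makes the values at 0 and -1 sufficient to compare two flows. *)
Lemma poly_deriv_const (p : {poly K}) c :
  p^`() = c%:P -> p.[0] = 0 -> p.[-1] = 0 -> c = 0 /\ p = 0.
Proof.
move=> dp p0 p1; have pE : p = c *: 'X.
  apply: subr0_eq; apply: deriv_inj0; last by rewrite !hornerE p0 ?mulr0 ?subr0.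
  by rewrite derivB dp derivZ derivX alg_polyC subrr.
have c0 : c = 0.
  by move: p1; rewrite pE !hornerE ?mulrN1 => /eqP; rewrite oppr_eq0 => /eqP.
by rewrite pE c0 scale0r.
Qed.

Lemma poly_nat_inj (p q : {poly K}) : (forall N, p.[N%:R] = q.[N%:R]) -> p = q.
Proof.
move=> pq; apply/subr0_eq/eqP; apply: contraT => d0.
pose s := [seq i%:R : K | i <- iota 0 (size (p - q))].
have s_roots : all (root (p - q)) s.
  by apply/allP => _ /mapP[i _ ->]; rewrite /root hornerD hornerN pq subrr.
have s_uniq : uniq s.
  rewrite map_inj_in_uniq ?iota_uniq // => i j _ _.
  wlog le_ij : i j / (i <= j)%N => [th ij|/esym/eqP].
    by case/orP: (leq_total i j) => ?; [|apply/esym]; apply: th.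
  by rewrite -subr_eq0 -natrB // natf_eq0 subn_eq0 => ?; apply/eqP; rewrite eqn_leq le_ij.
by have := max_poly_roots d0 s_roots s_uniq; rewrite size_map size_iota ltnn.
Qed.

(** The coefficients of log(1 + z); the value at j = 0 is 0 because 1 / 0 = 0. *)
Definition log_coef j : K := (-1) ^+ j.+1 / j%:R.

Fixpoint binom_poly k : {poly K} :=
  if k is k'.+1 then k%:R^-1 *: (('X - k'%:R%:P) * binom_poly k') else 1.

Lemma binom_poly_step k : ('X - k%:R%:P) * binom_poly k = k.+1%:R *: binom_poly k.+1.
Proof. by rewrite /= scalerA divff ?scale1r ?natSf_neq0. Qed.

Lemma binom_polyN1 k : (binom_poly k).[-1] = (-1) ^+ k.
Proof.
elim: k => [|k IH] /=; first by rewrite hornerC.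
rewrite hornerZ hornerM hornerXsubC IH -opprD nat1r mulNr mulrN mulrA mulVf ?natSf_neq0 //.
by rewrite mul1r exprS mulN1r.
Qed.

Lemma binom_poly_nat k N : (binom_poly k).[N%:R] = 'C(N, k)%:R.
Proof.
elim: k => [|k IH]; first by rewrite hornerC bin0.
rewrite /= hornerZ hornerM hornerXsubC IH; apply: (canLR (mulKf (natSf_neq0 k))).
have [kN|Nk] := leqP k N.
  by rewrite -natrB // -!natrM mul_bin_left.
by rewrite !bin_small // ?mulr0 // ltnW.
Qed.

(** Differentiation is log(1 + Delta), where the difference operator Delta lowers
    the index of a binomial polynomial by one. The proof differentiates
    (k + 1) binom(x, k + 1) = (x - k) binom(x, k). *)
Lemma deriv_binom_poly k :
  (binom_poly k)^`() = \sum_(j < k.+1) log_coef j *: binom_poly (k - j).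
Proof.
have c0 : log_coef 0 = 0 by rewrite /log_coef invr0 mulr0.
elim: k => [|k IH].
  by rewrite derivC big_ord_recl big_ord0 c0 scale0r addr0.
have nz := natSf_neq0 k; apply: (scalerI nz).
rewrite -derivZ -binom_poly_step derivM derivB derivX derivC subr0 mul1r IH mulr_sumr.
rewrite [in RHS]big_ord_recl c0 scale0r add0r.
have -> : \sum_(i < k.+1) ('X - k%:R%:P) * (log_coef i *: binom_poly (k - i)) =
   \sum_(i < k.+1) ((k.+1 - i)%:R * log_coef i) *: binom_poly (k.+1 - i)
   + \sum_(i < k.+1) (- (i%:R * log_coef i)) *: binom_poly (k - i).
  rewrite -big_split; apply: eq_bigr => i _ /=.
  have le_ik : (i <= k)%N by rewrite -ltnS.
  rewrite -scalerAr.
  (* This splitting lets the factor raise the index of binom_poly (k - i). *)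
  have -> : ('X - k%:R%:P : {poly K}) = ('X - (k - i)%:R%:P) - i%:R%:P.
    by rewrite -addrA -opprD -polyCD -natrD subnK.
  rewrite mulrBl binom_poly_step subSn // mul_polyC scalerBr !scalerA -scaleNr.
  by rewrite (mulrC (log_coef i) (_ - i).+1%:R) (mulrC (log_coef i) i%:R).
have jc j : j.+1%:R * log_coef j.+1 = (-1) ^+ j.
  by rewrite /log_coef mulrC divfK ?natSf_neq0 // !exprS mulrA mulrNN !mul1r.
rewrite [X in _ + (X + _)]big_ord_recl.
rewrite c0 mulr0 scale0r add0r.
rewrite [X in _ + (_ + X)]big_ord_recl mul0r oppr0 scale0r add0r.
have -> : \sum_(i < k) - ((lift ord0 i : nat)%:R * log_coef (lift ord0 i)) *:
    binom_poly (k - lift ord0 i) =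
    \sum_(i < k.+1) (-1) ^+ i *: binom_poly (k - i) - binom_poly k.
  rewrite [in RHS]big_ord_recl expr0 scale1r subn0 addrAC subrr add0r.
  by apply: eq_bigr => i _; rewrite lift0 jc exprS mulN1r.
have -> : \sum_(i < k) ((k.+1 - lift ord0 i)%:R * log_coef (lift ord0 i)) *:
    binom_poly (k.+1 - lift ord0 i) =
    \sum_(i < k.+1) ((k - i)%:R * log_coef i.+1) *: binom_poly (k - i).
  rewrite [RHS]big_ord_recr; set L := LHS; rewrite /= subnn mul0r scale0r addr0 /L.
  by apply: eq_bigr => i _; rewrite lift0 subSS.
rewrite addrA [LHS]addrC addrA subrK addrC.
rewrite scaler_sumr -big_split; apply: eq_bigr => i _.
have le_ik : (i <= k)%N by rewrite -ltnS.
by rewrite lift0 subSS /= scalerA -scalerDl -jc -mulrDl -natrD addnS subnK.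
Qed.

End CharZero.
Arguments binom_poly K k : simpl never.

(** * Layerings of a finite order *)

Lemma big_setUd (R : Type) (idx : R) (op : Monoid.com_law idx)
    (T : finType) (A B : {set T}) (F : T -> R) : [disjoint A & B] ->
  \big[op/idx]_(x in A :|: B) F x =
  op (\big[op/idx]_(x in A) F x) (\big[op/idx]_(x in B) F x).
Proof.
by move=> dAB; rewrite -bigU //=; apply: eq_bigl => x; rewrite !inE.
Qed.

Lemma big_powersetU (R : Type) (idx : R) (op : Monoid.com_law idx)
    (T : finType) (A B : {set T}) (F : {set T} -> R) : [disjoint A & B] ->
  \big[op/idx]_(U in powerset (A :|: B)) F U =
  \big[op/idx]_(U in powerset A) \big[op/idx]_(W in powerset B) F (U :|: W).
Proof.
move=> dAB; rewrite pair_big_dep /=.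
have capA (U W : {set T}) : U \subset A -> W \subset B -> (U :|: W) :&: A = U.
  move=> sUA sWB; rewrite setIUl (setIidPl sUA) -[RHS]setU0; congr (_ :|: _).
  by apply/disjoint_setI0; rewrite disjoint_sym (disjointWr sWB).
have capB (U W : {set T}) : U \subset A -> W \subset B -> (U :|: W) :&: B = W.
  move=> sUA sWB; rewrite setIUl (setIidPl sWB) -[RHS]set0U; congr (_ :|: _).
  by apply/disjoint_setI0; rewrite (disjointWl sUA).
rewrite (reindex_onto (fun p : {set T} * {set T} => p.1 :|: p.2)
   (fun U => (U :&: A, U :&: B))) /=; last first.
  by move=> U; rewrite powersetE => sU; rewrite -setIUr (setIidPl sU).
apply: eq_bigl => -[U W] /=; rewrite !powersetE.
apply/andP/andP => [[sU /eqP[<- <-]]|[sU sW]]; first by rewrite !subsetIr.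
by rewrite setUSS ?capA ?capB.
Qed.

Lemma sum_sign_powerset (R : pzRingType) (T : finType) (A : {set T}) :
  A != set0 -> \sum_(U in powerset A) (-1) ^+ #|U| = 0 :> R.
Proof.
case/set0Pn => a aA; rewrite -(setD1K aA) big_powersetU; last first.
  by rewrite disjoints1 !inE eqxx.
rewrite powerset1 big_setU1 ?big_set1 /=; last first.
  by rewrite inE eq_sym -card_gt0 cards1.
rewrite -big_split big1 //= => W; rewrite powersetE => sW.
rewrite set0U cardsU1 (_ : a \notin W) /=; first by rewrite exprS mulN1r subrr.
by apply: contraTN sW => aW; apply/subsetPn; exists a; rewrite // !inE eqxx.
Qed.

Section Layerings.

Variables (T : finType) (r : rel T).
Implicit Types V W M U : {set T}.

Definition minelts V := [set x in V | [forall y in V, ~~ r y x]].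

Definition upset V W :=
  (W \subset V) && [forall x in W, forall y in V, r x y ==> (y \in W)].

(** A layering peels off V, from the bottom, k nonempty sets of minimal elements;
    these are the fibres of a strictly increasing surjection from V onto
    {1, ..., k}, so that the number of layerings is omega_k. *)
Fixpoint layerings k V : nat :=
  if k is k'.+1 then
    (\sum_(M in powerset (minelts V) | M != set0) layerings k' (V :\: M))%N
  else (V == set0).

Lemma mineltsP V x :
  reflect (x \in V /\ forall y, y \in V -> ~~ r y x) (x \in minelts V).
Proof.
by rewrite inE; apply: (iffP andP) => -[xV h]; split=> //; apply/forall_inP.
Qed.

Lemma minelts_sub V : minelts V \subset V.
Proof. by apply/subsetP => x /mineltsP[]. Qed.

Lemma upsetP V W :
  reflect (W \subset V /\ forall x y, x \in W -> y \in V -> r x y -> y \in W)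
          (upset V W).
Proof.
apply: (iffP andP) => -[sW h]; split=> //.
  by move=> x y xW yV; move/forall_inP/(_ _ xW)/forall_inP/(_ _ yV)/implyP: h; apply.
by apply/forall_inP => x xW; apply/forall_inP => y yV; apply/implyP; apply: h xW yV.
Qed.

Lemma upset_sub V W : upset V W -> W \subset V.
Proof. by case/andP. Qed.

Lemma upset_refl V : upset V V.
Proof. exact/upsetP. Qed.

Lemma card_setD_lt V M : M \subset V -> M != set0 -> (#|V :\: M| < #|V|)%N.
Proof.
move=> sMV M0; rewrite cardsD (setIidPr sMV) ltn_subrL card_gt0 M0 /=.
by rewrite -card_gt0 in M0 *; apply: leq_trans M0 (subset_leq_card sMV).
Qed.

Lemma layerings_small k V : (#|V| < k)%N -> layerings k V = 0%N.
Proof.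
elim: k V => // k IH V lt_V; apply: big1 => M; rewrite powersetE => /andP[sM M0].
apply: IH; rewrite ltnS in lt_V; apply: leq_trans lt_V.
exact: card_setD_lt (subset_trans sM (minelts_sub V)) M0.
Qed.

Lemma layerings_set0 k : layerings k set0 = (k == 0%N).
Proof.
by case: k => [|k]; [rewrite /= eqxx | rewrite layerings_small ?cards0].
Qed.

(** Cut a layering above its first i layers: the part above the cut is up-closed,
    and every up-closed set arises. *)
Lemma layeringsD i j V :
  layerings (i + j) V =
  (\sum_(W | upset V W) layerings i (V :\: W) * layerings j W)%N.
Proof.
elim: i V => [|i IH] V.
  rewrite (bigD1 V) ?upset_refl //= setDv eqxx mul1n big1 ?addn0 // => W.
  case/andP=> /upset_sub sWV neqWV; rewrite setD_eq0.
  case: (boolP (V \subset W)) => //= sVW.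
  by rewrite eqEsubset sWV sVW in neqWV.
rewrite addSn /=; under eq_bigr do rewrite IH.
under [RHS]eq_bigr do rewrite big_distrl /=.
rewrite (exchange_big_dep (upset V)) /=; last first.
  move=> M W /andP[]; rewrite powersetE => /subsetP sM _ /upsetP[sW up].
  apply/upsetP; split=> [|x y xW yV rxy]; first exact: subset_trans sW (subsetDl _ _).
  apply: (up x) => //; rewrite inE yV andbT; apply/negP => /sM/mineltsP[_ /(_ x)].
  by rewrite rxy; move/subsetP/(_ _ xW): sW; rewrite inE => /andP[_ ->] => /(_ isT).
apply: eq_bigr => W /upsetP[/subsetP sWV upW]; apply: eq_big => [M|M _].
  rewrite !powersetE andbAC; congr (_ && _); apply/andP/subsetP.
    case=> /subsetP sM /upsetP[/subsetP sW up] x xM.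
    have /mineltsP[xV minx] := sM _ xM.
    apply/mineltsP; split=> [|y]; last by rewrite inE => /andP[_]; apply: minx.
    by rewrite inE xV andbT; apply: contraL xM => /sW; rewrite inE => /andP[].
  move=> sM; split.
    apply/subsetP => x /sM/mineltsP[]; rewrite inE => /andP[xW xV] minx.
    apply/mineltsP; split=> // y yV; apply/negP => ryx.
    have yW : y \in W.
      by apply: contraT => yW; have := minx y; rewrite inE yW yV ryx => /(_ isT).
    by rewrite (upW y x) in xW.
  apply/upsetP; split=> [|x y xW]; last by rewrite inE => /andP[_]; apply: upW.
  apply/subsetP => x xW; rewrite inE sWV // andbT.
  by apply/negP => /sM/mineltsP[]; rewrite inE xW.
by rewrite !setDDl setUC.
Qed.

End Layerings.

(** * Forests and strictly increasing maps *)

Section StrictOrder.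

Variables (T : finType) (r : rel T).
Hypotheses (r_irr : irreflexive r) (r_trans : transitive r).
Implicit Types V W M U : {set T}.

Definition up V x := [set y in V | (y == x) || r x y].

(** On a forest order, having a least element says that the Hasse diagram is a
    tree. *)
Definition tree V := [exists x in V, up V x == V].

Definition forest V :=
  {in V & &, forall x y z, r x z -> r y z -> [|| x == y, r x y | r y x]}.

Definition indep V W := [disjoint V & W] /\
  forall x y, x \in V -> y \in W -> ~~ r x y /\ ~~ r y x.

Lemma up_sub V x : up V x \subset V.
Proof. by apply/subsetP => y; rewrite inE => /andP[]. Qed.

Lemma mem_up V x : x \in V -> x \in up V x.
Proof. by move=> xV; rewrite inE xV eqxx. Qed.

Lemma up_trans V x y z : y \in up V x -> z \in V -> r y z -> z \in up V x.
Proof.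
rewrite !inE => /andP[yV /predU1P[->|rxy]] -> ryz; rewrite ?ryz ?orbT //=.
by rewrite (r_trans rxy ryz) orbT.
Qed.

Lemma treeP V :
  reflect (exists2 x, x \in V & forall y, y \in V -> y = x \/ r x y) (tree V).
Proof.
apply: (iffP exists_inP) => -[x xV h]; exists x => //.
  by move=> y; rewrite -{1}(eqP h) inE => /andP[_ /predU1P].
apply/eqP/setP => y; rewrite inE; case: (boolP (y \in V)) => //= yV.
by case: (h y yV) => [->|->]; rewrite ?eqxx ?orbT.
Qed.

Lemma tree_up V x : x \in V -> tree (up V x).
Proof.
move=> xV; apply/treeP; exists x; first exact: mem_up.
by move=> y; rewrite inE => /andP[_ /predU1P].
Qed.

Lemma tree_neq0 V : tree V -> V != set0.
Proof. by case/treeP => x xV _; apply/set0Pn; exists x. Qed.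

Lemma forest_sub V W : W \subset V -> forest V -> forest W.
Proof. by move=> /subsetP sWV fV x y z xW yW zW; apply: fV; apply: sWV. Qed.

Lemma minelts_neq0 V : V != set0 -> minelts r V != set0.
Proof.
case/set0Pn => x0 x0V.
case: (arg_minnP (fun x => #|[set y in V | r y x]|) x0V) => x xV xmin.
apply/set0Pn; exists x; apply/mineltsP; split=> // y yV; apply/negP => ryx.
have := xmin y yV; rewrite leqNgt => /negP[]; apply: proper_card.
apply/properP; split; last by exists y; rewrite !inE yV // r_irr.
by apply/subsetP => z; rewrite !inE => /andP[-> rzy]; apply: r_trans rzy ryx.
Qed.

(** The two parts are the elements above some minimal x, and the others: an element
    below something above x is comparable with x. *)
Lemma forest_split V : forest V -> V != set0 -> ~~ tree V ->
  exists V1 V2, [/\ V = V1 :|: V2, V1 != set0, V2 != set0 & indep V1 V2].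
Proof.
move=> fV /minelts_neq0/set0Pn[x /mineltsP[xV minx]] /negP ntV.
exists (up V x), (V :\: up V x).
have sU := up_sub V x; split.
- by rewrite -{1}(setID V (up V x)) (setIidPr sU).
- by apply/set0Pn; exists x; apply: mem_up.
- rewrite setD_eq0; apply/negP => sV; apply: ntV.
  suff -> : V = up V x by apply: tree_up.
  by apply/eqP; rewrite eqEsubset sV sU.
split.
  by rewrite disjoints_subset; apply/subsetP => y yU; rewrite in_setC in_setD yU.
move=> y z yU; rewrite in_setD => /andP[zU zV]; split.
  by apply: contraNN zU => /(up_trans yU zV).
apply/negP => rzy; have yV := subsetP sU _ yU.
move: yU; rewrite inE yV => /predU1P[yx|rxy].
  by have := minx z zV; rewrite -yx rzy.
have := fV x z y xV zV yV rxy rzy; rewrite (negPf (minx z zV)) orbF.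
by move=> xz; move: zU; rewrite inE zV /= eq_sym xz.
Qed.

Lemma mineltsU V W : indep V W -> minelts r (V :|: W) = minelts r V :|: minelts r W.
Proof.
case=> _ ind; apply/setP => x; apply/mineltsP/setUP.
  rewrite inE => -[/orP[xV|xW] minx]; [left|right]; apply/mineltsP; split=> //.
    by move=> y yV; apply: minx; rewrite inE yV.
  by move=> y yW; apply: minx; rewrite inE yW orbT.
case=> /mineltsP[xV minx]; rewrite inE xV ?orbT; split=> // y /setUP[|] yV.
- exact: minx.
- by case: (ind x y).
- by case: (ind y x).
- exact: minx.
Qed.

Lemma indepSS V W V' W' : V' \subset V -> W' \subset W -> indep V W -> indep V' W'.
Proof.
move=> sV sW [dVW ind]; split; first by apply: disjointWl sV (disjointWr sW dVW).
by move=> x y xV yW; apply: ind; [apply: (subsetP sV)|apply: (subsetP sW)].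
Qed.

(** The strictly increasing maps from V to {1, ..., N}, built fibre by fibre as
    [layerings], except that fibres may be empty. *)
Fixpoint nb_strict_maps N V : nat :=
  if N is N'.+1 then (\sum_(M in powerset (minelts r V)) nb_strict_maps N' (V :\: M))%N
  else (V == set0).

Lemma setDUU V W M U : [disjoint V & W] -> M \subset V -> U \subset W ->
  (V :|: W) :\: (M :|: U) = (V :\: M) :|: (W :\: U).
Proof.
move=> dVW sM sU; apply/setP => x; rewrite !inE.
case: (boolP (x \in M)) => [xM|_] /=.
  by rewrite (disjointFr dVW (subsetP sM x xM)) andbF.
by case: (boolP (x \in U)) => //= xU; rewrite (disjointFl dVW (subsetP sU x xU)).
Qed.

Lemma nb_strict_mapsU N V W : indep V W ->
  nb_strict_maps N (V :|: W) = (nb_strict_maps N V * nb_strict_maps N W)%N.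
Proof.
elim: N V W => [|N IH] V W ind /=; first by rewrite setU_eq0 mulnb.
rewrite mineltsU // big_powersetU; last first.
  by case: (indepSS (minelts_sub r V) (minelts_sub r W) ind).
rewrite big_distrl /=; apply: eq_bigr => M; rewrite powersetE => sM.
rewrite big_distrr /=; apply: eq_bigr => U; rewrite powersetE => sU.
have sMV := subset_trans sM (minelts_sub r V).
have sUW := subset_trans sU (minelts_sub r W).
have [dVW _] := ind; rewrite setDUU //; apply: IH.
exact: indepSS (subsetDl _ _) (subsetDl _ _) ind.
Qed.

(** A strictly increasing map is a layering together with the choice of its image. *)
Lemma nb_strict_mapsE N V :
  nb_strict_maps N V = (\sum_(k < #|T|.+1) 'C(N, k) * layerings r k V)%N.
Proof.
elim: N V => [|N IH] V.
  by rewrite big_ord_recl bin0 mul1n big1 ?addn0.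
rewrite /= (bigD1 set0) ?powersetE ?sub0set //= setD0 IH.
 under eq_bigr do rewrite IH.
rewrite exchange_big /=; under [X in _ + X = _]eq_bigr do rewrite -big_distrr /=.
rewrite [in LHS]big_ord_recl [in RHS]big_ord_recl !bin0 -[LHS]addnA; congr addn.
under [in RHS]eq_bigr do rewrite lift0 binS mulnDl.
rewrite [in RHS]big_split /=; congr (_ + _)%N.
rewrite big_ord_recr /= [X in (_ + _ * X)%N](_ : _ = 0%N) ?muln0 ?addn0 //.
exact: (@layerings_small _ r #|T|.+1 V (max_card V)).
Qed.

End StrictOrder.

(** * Order polynomials and the coefficients omega *)

Section OrderPolynomials.

Variables (K : fieldType) (charK : [pchar K] =i pred0).
Variables (T : finType) (r : rel T).
Hypotheses (r_irr : irreflexive r) (r_trans : transitive r).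
Implicit Types V W M U : {set T}.

Definition order_poly V : {poly K} :=
  \sum_(k < #|T|.+1) (layerings r k V)%:R *: binom_poly K k.

(** Applied to the blocks of P, this is the image of omega(P) in K, known as the
    Murua coefficient of the forest. *)
Definition murua V : K :=
  \sum_(k < #|T|.+1) log_coef K k * (layerings r k V)%:R.

Lemma order_poly_nat V N : (order_poly V).[N%:R] = (nb_strict_maps r N V)%:R.
Proof.
rewrite nb_strict_mapsE horner_sum natr_sum; apply: eq_bigr => k _.
by rewrite hornerZ (binom_poly_nat charK) natrM mulrC.
Qed.

Lemma order_poly_at0 V : (order_poly V).[0] = (V == set0)%:R.
Proof. by have := order_poly_nat V 0. Qed.

Lemma order_poly_set0 : order_poly set0 = 1.
Proof.
rewrite /order_poly big_ord_recl layerings_set0 scale1r big1 ?addr0 // => i _.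
by rewrite layerings_set0 scale0r.
Qed.

(** Both sides count strictly increasing maps at every natural number. *)
Lemma order_polyU V W : indep r V W -> order_poly (V :|: W) = order_poly V * order_poly W.
Proof.
move=> ind; apply: (poly_nat_inj charK) => N.
by rewrite hornerM !order_poly_nat nb_strict_mapsU // natrM.
Qed.

(** The derivative of binom(x, i + j) contributes log_coef j * binom(x, i), and
    [layeringsD] distributes the i + j layers over V - W and W. *)
Lemma deriv_order_poly V :
  (order_poly V)^`() = \sum_(W | upset r V W) murua W *: order_poly (V :\: W).
Proof.
have -> : (order_poly V)^`() =
    \sum_(i < #|T|.+1) \sum_(j < #|T|.+1)
      (log_coef K j * (layerings r (i + j) V)%:R) *: binom_poly K i.
  rewrite exchange_big /= raddf_sum /=.
  under eq_bigr do rewrite derivZ (deriv_binom_poly charK) scaler_sumr.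
  pose F k j := (log_coef K j * (layerings r k V)%:R) *: binom_poly K (k - j).
  (* Re-index by i = k - j; the added terms with i + j > #|T| vanish, since there
     are no layerings with that many layers. *)
  transitivity (\sum_(k < #|T|.+1) \sum_(j < #|T|.+1 | (j <= k)%N) F k j).
    apply: eq_bigr => k _; have lekT : (k.+1 <= #|T|.+1)%N by [].
    rewrite (big_ord_widen _ (fun j => (layerings r k V)%:R *:
      (log_coef K j *: binom_poly K (k - j))) lekT).
    by apply: eq_big => [//|j _]; rewrite scalerA mulrC.
  rewrite (exchange_big_dep xpredT) //=; apply: eq_bigr => j _.
  rewrite -(big_geq_mkord j #|T|.+1 xpredT (F^~ j)).
  rewrite -[X in index_iota X]add0n big_addn big_mkord.
  rewrite (big_ord_widen _ (fun i => F (i + j)%N j) (leq_subr j _)) big_mkcond /=.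
  apply: eq_bigr => i _; rewrite /F addnK; case: ifP => // /negbT.
  rewrite -leqNgt leq_subLR [(j + i)%N]addnC => gt_ij.
  rewrite layerings_small ?mulr0 ?scale0r //.
  exact: leq_ltn_trans (max_card V) gt_ij.
under eq_bigr => i _ do under eq_bigr => j _ do
  rewrite layeringsD natr_sum mulr_sumr scaler_suml.
under eq_bigr do rewrite exchange_big /=.
rewrite exchange_big /=; apply: eq_bigr => W _.
rewrite exchange_big /= scaler_suml; apply: eq_bigr => j _.
rewrite scaler_sumr; apply: eq_bigr => i _.
by rewrite scalerA natrM -mulrA [_%:R * _]mulrC.
Qed.

Lemma deriv_order_poly_at0 V : (order_poly V)^`().[0] = murua V.
Proof.
rewrite deriv_order_poly horner_sum (bigD1 V) ?upset_refl //= setDv hornerZ order_poly_at0.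
rewrite eqxx mulr1 big1 ?addr0 // => W /andP[/upset_sub sW neqWV].
rewrite hornerZ order_poly_at0 setD_eq0; case: (boolP (V \subset W)) => [sV|_].
  by rewrite eqEsubset sW sV in neqWV.
by rewrite mulr0.
Qed.

(** This is the linear coefficient of a product of two polynomials without
    constant term. *)
Lemma murua_indep V W : indep r V W -> V != set0 -> W != set0 ->
  murua (V :|: W) = 0.
Proof.
move=> ind V0 W0; rewrite -deriv_order_poly_at0 order_polyU // derivM hornerD !hornerM.
by rewrite !order_poly_at0 (negPf V0) (negPf W0) mul0r mulr0 addr0.
Qed.

Lemma murua_nontree V : forest r V -> ~~ tree r V -> murua V = 0.
Proof.
move=> fV ntV; have [->|V0] := eqVneq V set0.
  rewrite /murua big1 // => k _; rewrite layerings_set0 /log_coef.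
  by case: (nat_of_ord k) => [|k']; rewrite ?invr0 ?mulr0 ?mul0r.
by have [V1 [V2 [-> ? ? ?]]] := forest_split r_irr r_trans fV V0 ntV; exact: murua_indep.
Qed.

Lemma deriv_order_poly_forest V : forest r V ->
  (order_poly V)^`() = \sum_(W | upset r V W && tree r W) murua W *: order_poly (V :\: W).
Proof.
move=> fV; rewrite deriv_order_poly (bigID (tree r)) /= addrC big1 ?add0r // => W.
case/andP=> /upset_sub sW ntW.
by rewrite murua_nontree ?scale0r //; exact: forest_sub fV.
Qed.

(** Reciprocity at -1: peeling off the first layer turns the value at -1 into an
    alternating sum over the sets of minimal elements. *)
Lemma order_poly_atN1 V : (order_poly V).[-1] = (-1) ^+ #|V|.
Proof.
have [n] := ubnP #|V|; elim: n V => // n IH V; rewrite ltnS => leVn.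
have [->|V0] := eqVneq V set0; first by rewrite cards0 order_poly_set0 hornerC.
pose s M : K := (-1) ^+ #|V :\: M|.
have sMV M : M \subset minelts r V -> M \subset V.
  by move=> sM; apply: subset_trans (minelts_sub r V).
have -> : (order_poly V).[-1] = - \sum_(M in powerset (minelts r V) | M != set0) s M.
  transitivity (- \sum_(M in powerset (minelts r V) | M != set0)
                    (order_poly (V :\: M)).[-1]).
    rewrite horner_sum big_ord_recl /= (negPf V0) scale0r horner0 add0r.
    rewrite -sumrN; under [RHS]eq_bigr do rewrite horner_sum -sumrN.
    rewrite [RHS]exchange_big /= big_ord_recr /= [X in _ + X]big1 ?addr0 => [|M].
      apply: eq_bigr => k _; rewrite hornerZ (binom_polyN1 charK) natr_sum mulr_suml.
      apply: eq_bigr => M _; rewrite hornerZ (binom_polyN1 charK) exprS mulN1r.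
      by rewrite mulrN.
    rewrite powersetE => /andP[sM M0].
    rewrite layerings_small ?scale0r ?horner0 ?oppr0 //.
    exact: leq_trans (card_setD_lt (sMV _ sM) M0) (max_card V).
  congr (- _); apply: eq_bigr => M; rewrite powersetE => /andP[sM M0]; apply: IH.
  exact: leq_trans (card_setD_lt (sMV _ sM) M0) leVn.
have : \sum_(M in powerset (minelts r V)) s M = 0.
  transitivity ((-1) ^+ #|V| * \sum_(M in powerset (minelts r V)) (-1) ^+ #|M| : K).
    rewrite mulr_sumr; apply: eq_bigr => M; rewrite powersetE => /sMV sM.
    rewrite /s cardsD (setIidPr sM) -exprD.
    by rewrite -{2}(subnK (subset_leq_card sM)) -addnA exprD addnn -mul2n
                     exprM sqrrN !expr1n mulr1.
  by rewrite (sum_sign_powerset _ (minelts_neq0 r_irr r_trans V0)) mulr0.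
rewrite (bigD1 set0) ?powersetE ?sub0set //= /s setD0 => /eqP.
by rewrite addr_eq0 => /eqP ->.
Qed.

End OrderPolynomials.

(** * Hook products *)

Section Hooks.

Variables (K : fieldType) (charK : [pchar K] =i pred0).
Variables (T : finType) (r : rel T).
Hypotheses (r_irr : irreflexive r) (r_trans : transitive r).
Implicit Types V W M U : {set T}.

(** For the nesting order of a non-crossing partition P this is 1 / t(P)!, by
    [forest_fact_hook_weight]. On a forest it is the proportion of linear extensions
    among all orderings. *)
Definition hook_weight V : K := \prod_(x in V) #|up r V x|%:R^-1.

(** Every nonempty forest is a tree, to be peeled at its root, or splits into two
    unrelated forests. *)
Lemma forest_ind (P : {set T} -> Prop) :
  P set0 ->
  (forall V x, x \in V -> (forall y, y \in V -> y = x \/ r x y) ->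
     P (V :\ x) -> P V) ->
  (forall V W, indep r V W -> P V -> P W -> P (V :|: W)) ->
  forall V, forest r V -> P V.
Proof.
move=> P0 Ptree Pindep V; have [n] := ubnP #|V|; elim: n V => // n IH V.
rewrite ltnS => leVn fV; have [->//|V0] := eqVneq V set0.
case: (boolP (tree r V)) => [/treeP[x xV rootx]|ntV].
  apply: (Ptree V x) => //; apply: IH; last exact: forest_sub (subsetDl _ _) fV.
  by apply: leq_trans leVn; rewrite [X in (_ < X)%N](cardsD1 x) xV.
have [V1 [V2 [defV V10 V20 ind]]] := forest_split r_irr r_trans fV V0 ntV.
have [d12 _] := ind.
have cV : #|V| = (#|V1| + #|V2|)%N.
  by rewrite defV cardsU disjoint_setI0 // cards0 subn0.
rewrite defV; apply: Pindep => //; apply: IH.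
- by apply: leq_trans leVn; rewrite cV -addn1 leq_add2l card_gt0.
- by apply: forest_sub fV; rewrite defV subsetUl.
- by apply: leq_trans leVn; rewrite cV -add1n leq_add2r card_gt0.
- by apply: forest_sub fV; rewrite defV subsetUr.
Qed.

Lemma indepC V W : indep r V W -> indep r W V.
Proof.
case=> d ind; split; first by rewrite disjoint_sym.
by move=> x y xW yV; case: (ind y x).
Qed.

Lemma upU V W x : indep r V W -> x \in V -> up r (V :|: W) x = up r V x.
Proof.
case=> d ind xV; apply/setP => y; rewrite !inE.
case: (boolP (y \in W)) => yW; last by rewrite orbF.
rewrite (disjointFl d yW) /=; have [/negPf -> _] := ind x y xV yW.
by rewrite orbF; apply/eqP => yx; rewrite yx (disjointFr d xV) in yW.
Qed.

Lemma hook_weightU V W : indep r V W ->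
  hook_weight (V :|: W) = hook_weight V * hook_weight W.
Proof.
move=> ind; have [d _] := ind; rewrite /hook_weight big_setUd //=; congr (_ * _).
  by apply: eq_bigr => x xV; rewrite upU.
by apply: eq_bigr => x xW; rewrite setUC (upU (indepC ind) xW).
Qed.

Lemma upset1P V x :
  reflect (x \in V /\ forall y, y \in V -> ~~ r x y) (upset r V [set x]).
Proof.
apply: (iffP (upsetP _ _ _)) => -[].
  rewrite sub1set => xV up; split=> // y yV; apply/negP => rxy.
  by have := up x y; rewrite !inE eqxx => /(_ isT yV rxy)/eqP yx; rewrite yx r_irr in rxy.
move=> xV up; rewrite sub1set; split=> // y z; rewrite inE => /eqP -> zV rxz.
by rewrite (negPf (up z zV)) in rxz.
Qed.

Lemma upset1U V W x : indep r V W -> x \in V ->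
  upset r (V :|: W) [set x] = upset r V [set x].
Proof.
case=> _ ind xV; apply/upset1P/upset1P => -[_ up]; split=> //; rewrite ?inE ?xV //.
  by move=> y yV; apply: up; rewrite inE yV.
by move=> y /setUP[/up //|yW]; case: (ind x y).
Qed.

Lemma hook_weight_root V x : x \in V -> (forall y, y \in V -> y = x \/ r x y) ->
  hook_weight V = #|V|%:R^-1 * hook_weight (V :\ x).
Proof.
move=> xV rootx; rewrite /hook_weight (big_setD1 x) //=; congr (_%:R^-1 * _).
  apply: eq_card => y; rewrite inE; case: (boolP (y \in V)) => //= /rootx[->|->].
    by rewrite eqxx.
  by rewrite orbT.
apply: eq_bigr => y; rewrite !inE => /andP[neqyx yV]; congr (_%:R^-1).
apply: eq_card => z; rewrite !inE; case: (eqVneq z x) => //= ->.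
rewrite xV eq_sym (negPf neqyx) /=; apply/negP => ryx.
case: (rootx y yV) => [yx|rxy]; first by rewrite yx eqxx in neqyx.
by have := r_trans rxy ryx; rewrite r_irr.
Qed.

(** With hook_weight V = e(V) / |V|! for e(V) the number of linear extensions, this
    sorts the linear extensions by their last element. By induction: the
    weight of V is that of V - x divided by |V| when x is a root, and weights of
    unrelated parts multiply, which gives a product rule. *)
Lemma hook_weight_rem_leaf V : forest r V ->
  #|V|%:R * hook_weight V = \sum_(x | upset r V [set x]) hook_weight (V :\ x).
Proof.
move: V; apply: forest_ind => [|V x xV rootx IH|V W ind IHV IHW].
- by rewrite cards0 mul0r big1 // => x /upset1P[]; rewrite inE.
- have V_neq0 : #|V|%:R != 0 :> K.
    by rewrite natf_eq0 // cards_eq0; apply/set0Pn; exists x.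
  rewrite (hook_weight_root xV rootx) mulrA divff // mul1r.
  have [VD0|[z zVD]] := set_0Vmem (V :\ x).
    have defV : V = [set x] by rewrite -(setD1K xV) VD0 setU0.
    rewrite (big_pred1 x) // => y; rewrite defV; apply/upset1P/eqP; rewrite inE.
      by case=> /eqP.
    by move=> ->; split=> // t; rewrite inE => /eqP ->; rewrite r_irr.
  have zV : z \in V by case/setD1P: zVD.
  have rxz : r x z by case: (rootx z zV) => // zx; rewrite zx !inE eqxx in zVD.
  have VD_neq0 : #|V :\ x|%:R != 0 :> K.
    by rewrite natf_eq0 // cards_eq0; apply/set0Pn; exists z.
  (* V - y is again a tree with root x, for every leaf y of V - x. *)
  have -> : hook_weight (V :\ x) = #|V :\ x|%:R^-1 * (#|V :\ x|%:R * hook_weight (V :\ x)).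
    by rewrite mulrA mulVf ?mul1r.
  rewrite IH mulr_sumr; apply: eq_big => y.
    apply/upset1P/upset1P; rewrite !inE.
      case=> /andP[neqyx yV] up; split=> // t tV.
      case: (eqVneq t x) => [->|tx]; last by apply: up; rewrite !inE tx.
      case: (rootx y yV) => [yx|rxy]; first by rewrite yx eqxx in neqyx.
      by apply/negP => /(r_trans rxy); rewrite r_irr.
    case=> yV up; split; last by move=> t /setD1P[_ /up].
    by rewrite yV andbT; apply: contraTneq rxz => <-; apply: up.
  case/upset1P; rewrite !inE => /andP[neqyx yV] _.
  rewrite (@hook_weight_root (V :\ y) x) ?inE ?(eq_sym x) ?neqyx ?xV //; last first.
    by move=> t /setD1P[_ /rootx].
  rewrite !setDDl [[set y] :|: _]setUC; congr (_%:R^-1 * _).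
  by have := cardsD1 x V; rewrite (cardsD1 y V) xV yV => /addnI ->.
have [d _] := ind.
rewrite hook_weightU // cardsU disjoint_setI0 // cards0 subn0 natrD mulrDl.
rewrite mulrA IHV mulrCA IHW mulr_suml mulr_sumr.
rewrite [RHS](bigID (fun x => x \in V)) /=; congr (_ + _).
  apply: eq_big => [x|x /upset1P[xV _]].
    case: (boolP (x \in V)) => xV; first by rewrite upset1U ?andbT.
    by rewrite andbF; apply/negP => /upset1P[]; rewrite (negPf xV).
  rewrite -hook_weightU; last exact: indepSS (subsetDl _ _) (subxx _) ind.
  rewrite setDUl; suff -> : W :\ x = W by [].
  by apply/setDidPl; rewrite disjoint_sym disjoints1 (disjointFr d).
apply: eq_big => [x|x /upset1P[xW _]].
  case: (boolP (x \in W)) => xW.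
    by rewrite setUC (upset1U (indepC ind) xW) (disjointFl d xW) andbT.
  apply/idP/idP => [/upset1P[]|/andP[/upset1P[]]]; rewrite ?inE ?(negPf xW) //.
  by rewrite orbF => ->.
rewrite -hook_weightU; last exact: indepSS (subxx _) (subsetDl _ _) ind.
rewrite setDUl; suff -> : V :\ x = V by [].
by apply/setDidPl; rewrite disjoint_sym disjoints1 (disjointFl d).
Qed.

Definition hook_poly V : {poly K} := hook_weight V *: 'X^#|V|.

Lemma deriv_hook_poly V : forest r V -> (hook_poly V)^`() =
  \sum_(W | upset r V W && tree r W) (#|W| == 1%N)%:R *: hook_poly (V :\: W).
Proof.
move=> fV; rewrite derivZ derivXn -scaler_nat scalerA mulrC hook_weight_rem_leaf //.
rewrite scaler_suml.
transitivity (\sum_(W in [set [set x] | x in [set x | upset r V [set x]]])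
  hook_poly (V :\: W)).
  rewrite big_imset /=; last by move=> x y _ _; apply: set1_inj.
  apply: eq_big => [x|x /upset1P[xV _]]; first by rewrite inE.
  by rewrite /hook_poly (cardsD1 x V) xV.
rewrite [RHS](bigID (fun W => #|W| == 1%N)) /= [X in _ + X]big1 ?addr0; last first.
  by move=> W /andP[_ /negPf ->]; rewrite scale0r.
apply: eq_big => [W|W]; last by case/imsetP => x _ ->; rewrite cards1 scale1r.
apply/imsetP/idP => [[x]|/andP[/andP[upW _] /cards1P[x defW]]].
  rewrite inE => upx ->; rewrite upx cards1 andbT.
  apply/treeP; exists x => [|y]; first exact: set11.
  by rewrite inE => /eqP; left.
by exists x; rewrite // inE -defW.
Qed.

Lemma hook_poly_set0 : hook_poly set0 = 1.
Proof. by rewrite /hook_poly /hook_weight big_set0 cards0 scale1r. Qed.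

Lemma hook_poly_at0 V : (hook_poly V).[0] = (V == set0)%:R.
Proof.
rewrite hornerZ hornerXn expr0n cards_eq0; case: eqP => [->|_]; last by rewrite mulr0.
by rewrite /hook_weight big_set0 mulr1.
Qed.

Lemma hook_poly_atN1 V : (hook_poly V).[-1] = (-1) ^+ #|V| * hook_weight V.
Proof. by rewrite hornerZ hornerXn mulrC. Qed.

End Hooks.

(** * Cutting non-crossing partitions along intervals *)

(** Pointwise form of [partition], convenient when blocks are added or removed. *)
Lemma partition_iff (T : finType) (P : {set {set T}}) (X : {set T}) :
  partition P X <->
  [/\ set0 \notin P, forall x, x \in X <-> exists2 B, B \in P & x \in B
    & forall B C x, B \in P -> C \in P -> x \in B -> x \in C -> B = C].
Proof.
split=> [/and3P[/eqP <- /trivIsetP tP P0]|[P0 covP tP]].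
  split=> // [x|B C x BP CP xB xC]; first by split=> /bigcupP.
  apply/eqP; apply: contraT => /(tP _ _ BP CP) /disjointFr/(_ xB).
  by rewrite xC.
apply/and3P; split=> //.
  by apply/eqP/setP => x; apply/bigcupP/idP => /covP.
apply/trivIsetP => B C BP CP; apply: contraNT => /pred0Pn[x /andP[xB xC]].
by apply/eqP; apply: tP xB xC.
Qed.

Section Noncrossing.

Variable n : nat.
Implicit Types (X I B C D : {set 'I_n}) (P Q W : {set {set 'I_n}}).

Definition ncp X := [set P | partition P X & noncrossing P].

(** These are the irreducible partitions of X, see [NCirr_nctree]. *)
Definition nctree X := [set P in ncp X | tree (@nested n) P].

(** Convexity is relative to X: the points of I are consecutive among those of X. *)
Definition interval X I := [&& I != set0, I \subset X &
  [forall i in I, forall j in I, forall x in X, (i <= x <= j)%N ==> (x \in I)]].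

Lemma intervalP X I :
  reflect [/\ I != set0, I \subset X & forall i j x, i \in I -> j \in I ->
             x \in X -> (i <= x)%N -> (x <= j)%N -> x \in I]
          (interval X I).
Proof.
apply: (iffP and3P) => -[I0 sI h]; split=> //.
  move=> i j x iI jI xX ix xj.
  move/forall_inP/(_ i iI)/forall_inP/(_ j jI)/forall_inP/(_ x xX)/implyP: h.
  by rewrite ix xj; apply.
apply/forall_inP => i iI; apply/forall_inP => j jI; apply/forall_inP => x xX.
by apply/implyP => /andP[]; apply: h.
Qed.

Lemma interval_refl X : X != set0 -> interval X X.
Proof. by move=> X0; apply/intervalP; split. Qed.

Lemma nestedP B C :
  reflect (exists x y, [/\ x \in B, y \in B & forall z, z \in C -> (x < z < y)%N])
          (nested B C).
Proof.
apply: (iffP exists_inP) => [[x xB /exists_inP[y yB /forall_inP h]]|[x [y [xB yB h]]]].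
  by exists x, y.
by exists x => //; apply/exists_inP; exists y => //; apply/forall_inP.
Qed.

Lemma nested_irr : irreflexive (@nested n).
Proof.
by move=> B; apply/nestedP => -[x [y [xB _ /(_ x xB)]]]; rewrite ltnn.
Qed.

Lemma nested_trans : transitive (@nested n).
Proof.
move=> C B D /nestedP[x [y [xB yB h]]] /nestedP[x' [y' [/h/andP[xx' _] /h/andP[_ y'y] h']]].
apply/nestedP; exists x, y; split=> // z /h' /andP[lt1 lt2].
by rewrite (ltn_trans xx' lt1) (ltn_trans lt2 y'y).
Qed.

Lemma noncrossingP P :
  reflect (forall B C i j k l, B \in P -> C \in P -> B != C ->
             i \in B -> j \in C -> k \in B -> l \in C ->
             (i < j)%N -> (j < k)%N -> (k < l)%N -> False)
          (noncrossing P).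
Proof.
apply: (iffP forall_inP) => [h B C i j k l BP CP BC iB jC kB lC ij jk kl|h B BP].
  move/forall_inP/(_ C CP)/implyP/(_ BC)/negP: (h B BP); apply.
  apply/exists_inP; exists i => //; apply/exists_inP; exists j => //.
  apply/exists_inP; exists k => //; apply/exists_inP; exists l => //.
  by rewrite ij jk.
apply/forall_inP => C CP; apply/implyP => BC; apply/negP.
case/exists_inP => i iB /exists_inP[j jC /exists_inP[k kB /exists_inP[l lC]]].
by case/and3P; apply: h BP CP BC iB jC kB lC.
Qed.

Lemma noncrossing_sub P W : W \subset P -> noncrossing P -> noncrossing W.
Proof.
move=> /subsetP sWP /noncrossingP nc; apply/noncrossingP => B C i j k l BW CW.
by apply: nc; apply: sWP.
Qed.

(** A block with one point between two points of B cannot leave this gap without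
    crossing B. *)
Lemma nested_between X P B D b x b' : P \in ncp X -> B \in P -> D \in P ->
  B != D -> b \in B -> b' \in B -> x \in D -> (b < x)%N -> (x < b')%N -> nested B D.
Proof.
rewrite inE => /andP[/partition_iff[_ _ tP] /noncrossingP nc] BP DP BD bB b'B xD bx xb'.
apply/nestedP; exists b, b'; split=> // z zD; apply/andP; split.
  rewrite ltnNge leq_eqVlt; apply/negP => /orP[/eqP/val_inj zb|zb].
    by rewrite zb in zD; rewrite (tP B D b) // eqxx in BD.
  by apply: (nc D B z b x b'); rewrite // eq_sym.
rewrite ltnNge leq_eqVlt; apply/negP => /orP[/eqP/val_inj zb|zb].
  by rewrite -zb in zD; rewrite (tP B D b') // eqxx in BD.
exact: (nc B D b x b' z).
Qed.

(** Of two blocks around D, the one whose left witness comes second has a point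
    inside the other. *)
Lemma ncp_forest X P : P \in ncp X -> forest (@nested n) P.
Proof.
move=> PX B C D BP CP DP /nestedP[x [y [xB yB h]]] /nestedP[x' [y' [x'C y'C h']]].
have := PX; rewrite inE => /andP[/partition_iff[P0 _ tP] _].
have [//|BC] := eqVneq B C.
have [D0|[z zD]] := set_0Vmem D; first by rewrite -D0 DP in P0.
have /andP[xz zy] := h z zD; have /andP[x'z zy'] := h' z zD.
case: (ltngtP x x') => [xx'|x'x|/val_inj xx'].
- by rewrite (nested_between PX BP CP BC xB yB x'C) // (ltn_trans x'z).
- have CB : C != B by rewrite eq_sym.
  by rewrite (nested_between PX CP BP CB x'C y'C xB) ?orbT ?(ltn_trans xz).
- by rewrite -xx' in x'C; rewrite (tP B C x) // eqxx in BC.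
Qed.

Lemma ncp_neq0 X P B : P \in ncp X -> B \in P -> exists x, x \in B.
Proof.
rewrite inE => /andP[/partition_iff[P0 _ _] _] BP.
by have [B0|[x xB]] := set_0Vmem B; [rewrite B0 (negPf P0) in BP | exists x].
Qed.

Lemma ncp_mem X P B x : P \in ncp X -> B \in P -> x \in B -> x \in X.
Proof.
by rewrite inE => /andP[/partition_iff[_ cP _] _] BP xB; apply/cP; exists B.
Qed.

(** W covers all points of X between the extreme points of its least block B: a block
    with such a point is B or nested in B, hence belongs to W. *)
Lemma ncp_cut X P W : P \in ncp X -> upset (@nested n) P W ->
  tree (@nested n) W ->
  [/\ interval X (cover W), W \in nctree (cover W) & P :\: W \in ncp (X :\: cover W)].
Proof.
move=> PX /upsetP[sWP up] tW; have /subsetP sW := sWP.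
have := PX; rewrite inE => /andP[/partition_iff[P0 cP tP] nc].
case/treeP: (tW) => B BW root; have BP := sW B BW.
split.
- apply/intervalP; split.
  + have [x xB] := ncp_neq0 PX BP.
    by apply/set0Pn; exists x; apply/bigcupP; exists B.
  + by apply/subsetP => x /bigcupP[C /sW CP xC]; apply/cP; exists C.
  move=> i j x /bigcupP[C CW iC] /bigcupP[C' C'W jC'] xX ix xj.
  have [b bB bi] : exists2 b, b \in B & (b <= i)%N.
    have [CB|/nestedP[b [b' [bB _ h]]]] := root C CW; first by exists i; rewrite -?CB.
    by exists b => //; apply: ltnW; case/andP: (h i iC).
  have [b' b'B jb'] : exists2 b', b' \in B & (j <= b')%N.
    have [CB|/nestedP[b0 [b' [_ b'B h]]]] := root C' C'W; first by exists j; rewrite -?CB.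
    by exists b' => //; apply: ltnW; case/andP: (h j jC').
  have /cP[D DP xD] := xX; apply/bigcupP; exists D => //.
  have [<-//|BD] := eqVneq B D; apply: (up B) => //.
  have neqx c : c \in B -> c != x.
    by move=> cB; apply: contraNneq BD => cx; rewrite (tP B D x) // -cx.
  apply: (nested_between PX BP DP BD bB b'B xD).
    by rewrite ltn_neqAle (leq_trans bi ix) andbT; apply: neqx.
  by rewrite ltn_neqAle (leq_trans xj jb') andbT eq_sym; apply: neqx.
- rewrite 2!inE tW (noncrossing_sub sWP nc) !andbT; apply/partition_iff; split.
  + by apply: contra P0; apply: sW.
  + by move=> x; split=> /bigcupP.
  + by move=> C D x /sW CP /sW DP; apply: tP.
- rewrite inE (noncrossing_sub (subsetDl P W) nc) andbT; apply/partition_iff; split.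
  + by rewrite inE negb_and (negPf P0) orbT.
  + move=> x; rewrite inE; split.
      case/andP=> xW /cP[C CP xC]; exists C; rewrite // inE CP andbT.
      by apply: contra xW => CW; apply/bigcupP; exists C.
    case=> C; rewrite inE => /andP[CW CP] xC; apply/andP; split; last by apply/cP; exists C.
    apply: contra CW => /bigcupP[D DW xD].
    by rewrite (tP C D x) // sW.
  + by move=> C D x /setDP[CP _] /setDP[DP _]; apply: tP.
Qed.

(** Converse of [ncp_cut]: blocks of P avoid the interval I, so that they neither
    cross the blocks of Q nor are nested in them. *)
Lemma ncp_glue X I P Q : interval X I -> Q \in nctree I -> P \in ncp (X :\: I) ->
  [/\ P :|: Q \in ncp X, upset (@nested n) (P :|: Q) Q, tree (@nested n) Q,
      cover Q = I & (P :|: Q) :\: Q = P].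
Proof.
move=> /intervalP[I0 /subsetP sI conv]; rewrite inE => /andP[QI tQ] PX.
have := PX; rewrite inE => /andP[/partition_iff[P0 cP tP] /noncrossingP ncP].
have := QI; rewrite inE => /andP[partQ /noncrossingP ncQ].
have [Q0 cQ tQ'] := (partition_iff _ _).1 partQ.
have inX B x : B \in P -> x \in B -> x \in X.
  by move=> BP xB; case/setDP: (ncp_mem PX BP xB).
have notI B x : B \in P -> x \in B -> x \notin I.
  by move=> BP xB; case/setDP: (ncp_mem PX BP xB).
have inI B x : B \in Q -> x \in B -> x \in I := fun BQ xB => ncp_mem QI BQ xB.
split=> //; last 1 first.
- apply/setP => B; rewrite !inE; case: (boolP (B \in Q)) => BQ /=; last by rewrite orbF.
  have [x xB] := ncp_neq0 QI BQ.
  by apply/esym/negP => /notI/(_ xB); rewrite (inI B).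
- rewrite inE; apply/andP; split.
    apply/partition_iff; split; first by rewrite inE negb_or P0.
      move=> x; split.
        move=> xX; case: (boolP (x \in I)) => [/cQ[B BQ xB]|xI].
          by exists B; rewrite // inE BQ orbT.
        have /cP[B BP xB] : x \in X :\: I by rewrite inE xI.
        by exists B; rewrite // inE BP.
      by case=> B /setUP[BP|BQ] xB; [apply: inX xB | apply/sI/(inI B)].
    move=> B C x /setUP[BP|BQ] /setUP[CP|CQ] xB xC.
    - exact: tP xB xC.
    - by have := notI B x BP xB; rewrite (inI C).
    - by have := notI C x CP xC; rewrite (inI B).
    - exact: tQ' xB xC.
  apply/noncrossingP => B C i j k l /setUP[BP|BQ] /setUP[CP|CQ] BC iB jC kB lC ij jk kl.
  - exact: (ncP B C i j k l).
  - have /negP[] := notI B k BP kB.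
    exact: (conv j l k (inI C j CQ jC) (inI C l CQ lC) (inX B k BP kB) (ltnW jk) (ltnW kl)).
  - have /negP[] := notI C j CP jC.
    exact: (conv i k j (inI B i BQ iB) (inI B k BQ kB) (inX C j CP jC) (ltnW ij) (ltnW jk)).
  - exact: (ncQ B C i j k l).
- apply/upsetP; split=> [|B C BQ /setUP[CP|//] /nestedP[x [y [xB yB h]]]].
    exact: subsetUr.
  have [z zC] := ncp_neq0 PX CP; have /andP[xz zy] := h z zC.
  have /negP[] := notI C z CP zC.
  exact: (conv x y z (inI B x BQ xB) (inI B y BQ yB) (inX C z CP zC) (ltnW xz) (ltnW zy)).
- by apply/eqP; case/and3P: partQ.
Qed.

Lemma sum_ncp_cut (R : nmodType) X (F : {set {set 'I_n}} -> {set {set 'I_n}} -> R) :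
  \sum_(P in ncp X) \sum_(W | upset (@nested n) P W && tree (@nested n) W) F (P :\: W) W =
  \sum_(I | interval X I) \sum_(Q in nctree I) \sum_(P in ncp (X :\: I)) F P Q.
Proof.
rewrite pair_big_dep /= (partition_big (fun p => cover p.2) (interval X)) /=; last first.
  by move=> [P W] /= /and3P[PX up tW]; case: (ncp_cut PX up tW).
apply: eq_bigr => I intI; rewrite pair_big_dep /=.
(* The pair (Q, P) comes from the partition P :|: Q cut along Q. *)
rewrite (reindex_onto (fun q : {set {set 'I_n}} * {set {set 'I_n}} => (q.2 :|: q.1, q.1))
  (fun p => (p.2, p.1 :\: p.2))) /=; last first.
  move=> [P W] /= /andP[/and3P[_ /upset_sub sWP _] _].
  by rewrite setUC -{1}(setIidPr sWP) setID.
apply: eq_big => [[Q P]|[Q P]] /=.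
  apply/andP/andP => [[/andP[/and3P[PX up tQ] /eqP <-] /eqP[<-]]|[QI PX]].
    by case: (ncp_cut PX up tQ).
  by have [-> -> -> -> ->] := ncp_glue intI QI PX; rewrite !eqxx.
by case/andP=> _ /eqP[->].
Qed.

End Noncrossing.

(** * Generating polynomials of non-crossing partitions *)

Section GeneratingFunctions.

Variables (K : fieldType) (charK : [pchar K] =i pred0) (n : nat).
Implicit Types (X I : {set 'I_n}) (P Q W : {set {set 'I_n}}).

Section OneFamily.

Variables (y : {set {set 'I_n}} -> {poly K}) (e : {set {set 'I_n}} -> K).
Variable k : {set 'I_n} -> K.
Hypothesis deriv_y : forall P, forest (@nested n) P ->
  (y P)^`() = \sum_(W | upset (@nested n) P W && tree (@nested n) W)
                e W *: y (P :\: W).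
Hypothesis y_at0 : forall P, (y P).[0] = (P == set0)%:R.

Definition ncp_gf X : {poly K} := \sum_(P in ncp X) (\prod_(B in P) k B) *: y P.

Definition nctree_sum X : K := \sum_(P in nctree X) e P * \prod_(B in P) k B.

(** The recursion for y_P is a sum over pairs (P, W); [sum_ncp_cut] regroups these
    by the interval that W covers. *)
Lemma deriv_ncp_gf X :
  (ncp_gf X)^`() = \sum_(I | interval X I) nctree_sum I *: ncp_gf (X :\: I).
Proof.
pose F P W := (e W * \prod_(B in W) k B) *: ((\prod_(B in P) k B) *: y P).
rewrite raddf_sum /=; transitivity (\sum_(P in ncp X)
    \sum_(W | upset (@nested n) P W && tree (@nested n) W) F (P :\: W) W).
  apply: eq_bigr => P PX; rewrite derivZ (deriv_y (ncp_forest PX)) scaler_sumr.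
  apply: eq_bigr => W /andP[/upset_sub sWP _].
  rewrite [in LHS](big_setID W) /= (setIidPr sWP) /F !scalerA; congr (_ *: _).
  by rewrite mulrC mulrA.
rewrite (sum_ncp_cut X F); apply: eq_bigr => I _; rewrite scaler_suml.
by apply: eq_bigr => Q _; rewrite scaler_sumr.
Qed.

Lemma ncp_set0 : ncp (set0 : {set 'I_n}) = [set set0].
Proof.
apply/setP => P; rewrite !inE; apply/andP/eqP => [[/partition_iff[P0 cP _] _]|->].
  apply/eqP; rewrite -subset0; apply/subsetP => B BP.
  have [B0|[x xB]] := set_0Vmem B; first by rewrite -B0 BP in P0.
  have [_ xP] := cP x; suff : x \in (set0 : {set 'I_n}) by rewrite inE.
  by apply: xP; exists B.
split; last by apply/forall_inP => B; rewrite inE.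
apply/partition_iff; split; rewrite ?inE // => x; last by move=> B C; rewrite inE.
by rewrite inE; split=> // -[B]; rewrite inE.
Qed.

Lemma ncp_gf_at0 X : X != set0 -> (ncp_gf X).[0] = 0.
Proof.
case/set0Pn => x xX; rewrite horner_sum big1 // => P.
rewrite inE => /andP[/partition_iff[_ /(_ x)[/(_ xX)[B BP _] _] _] _].
rewrite hornerZ y_at0; case: eqP => [P0|_]; last by rewrite mulr0.
by rewrite P0 inE in BP.
Qed.

End OneFamily.

(** By induction on X all terms of the two equations agree except the one with
    I = X, so that the difference of Y1 X and Y2 X has the constant derivative
    E1 X - E2 X; it vanishes at 0 and -1. *)
Lemma interval_flow_unique (Y1 Y2 : {set 'I_n} -> {poly K}) (E1 E2 : {set 'I_n} -> K) :
  (forall X, (Y1 X)^`() = \sum_(I | interval X I) E1 I *: Y1 (X :\: I)) ->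
  (forall X, (Y2 X)^`() = \sum_(I | interval X I) E2 I *: Y2 (X :\: I)) ->
  Y1 set0 = 1 -> Y2 set0 = 1 ->
  (forall X, X != set0 -> (Y1 X).[0] = 0) ->
  (forall X, X != set0 -> (Y2 X).[0] = 0) ->
  (forall X, X != set0 -> (Y1 X).[-1] = (Y2 X).[-1]) ->
  forall X, X != set0 -> E1 X = E2 X.
Proof.
move=> dY1 dY2 Y10 Y20 Y1_at0 Y2_at0 Y12 X X0.
suff [] : E1 X = E2 X /\ Y1 X = Y2 X by [].
have [m] := ubnP #|X|; elim: m X X0 => // m IH X X0; rewrite ltnS => leXm.
have dY12 : (Y1 X - Y2 X)^`() = (E1 X - E2 X)%:P.
  rewrite derivB dY1 dY2 (bigD1 X) ?interval_refl //= setDv Y10.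
  rewrite [X in _ - X](bigD1 X) ?interval_refl //= setDv Y20 !alg_polyC.
  (* Remain the intervals I other than X, whose terms agree by induction. *)
  rewrite opprD addrACA -polyCN -polyCD addrC; apply/eqP; rewrite -subr_eq0 addrK subr_eq0.
  apply/eqP/subr0_eq; rewrite -sumrB big1 // => I /andP[/intervalP[I0 sIX _] neqIX].
  have ltIX : (#|I| < #|X|)%N by apply: proper_card; rewrite properEneq neqIX.
  have [-> _] := IH I I0 (leq_trans ltIX leXm).
  have XI0 : X :\: I != set0.
    by rewrite setD_eq0; apply: contraNN neqIX => sXI; rewrite eqEsubset sIX.
  have [_ ->] := IH (X :\: I) XI0 (leq_trans (card_setD_lt sIX I0) leXm).
  by rewrite subrr.
have [] := poly_deriv_const charK dY12.
- by rewrite hornerD hornerN Y1_at0 ?Y2_at0 ?subrr.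
- by rewrite hornerD hornerN Y12 ?subrr.
by move=> /subr0_eq -> /subr0_eq ->.
Qed.

End GeneratingFunctions.

(** * Invariance under order embeddings *)

Section OrderEmbedding.

Variables (T T' : finType) (r : rel T) (r' : rel T') (f : T -> T') (X : {set T}).
Hypotheses (f_inj : {in X &, injective f}).
Hypothesis f_mono : {in X &, {mono f : x y / r x y >-> r' x y}}.
Implicit Types V M : {set T}.

Lemma mem_imset_sub M x : M \subset X -> x \in X -> (f x \in f @: M) = (x \in M).
Proof.
move=> /subsetP sMX xX; apply/imsetP/idP => [[y yM eqxy]|xM]; last by exists x.
by rewrite (f_inj xX (sMX y yM) eqxy).
Qed.

Lemma imset_inj_sub (M N : {set T}) : M \subset X -> N \subset X ->
  f @: M = f @: N -> M = N.
Proof.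
move=> sMX sNX eqMN; apply/setP => x.
have [xX|xX] := boolP (x \in X).
  by rewrite -(mem_imset_sub sMX xX) eqMN mem_imset_sub.
by rewrite (contraNF (subsetP sMX x) xX) (contraNF (subsetP sNX x) xX).
Qed.

Lemma big_powerset_imset (R : Type) (idx : R) (op : Monoid.com_law idx)
    (V : {set T}) (Q : pred {set T'}) (F : {set T'} -> R) : V \subset X ->
  \big[op/idx]_(M in powerset (f @: V) | Q M) F M =
  \big[op/idx]_(M in powerset V | Q (f @: M)) F (f @: M).
Proof.
move=> sVX; have -> : powerset (f @: V) = (fun M : {set T} => f @: M) @: powerset V.
  apply/setP => M; rewrite powersetE; apply/idP/imsetP => [sM|[N]]; last first.
    by rewrite powersetE => sNV ->; apply: imsetS.
  exists [set x in V | f x \in M].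
    by rewrite powersetE; apply/subsetP => x; rewrite inE => /andP[].
  apply/setP => y; apply/idP/imsetP => [yM|[x]]; last by rewrite inE => /andP[_ ?] ->.
  have /imsetP[x xV yE] := subsetP sM y yM.
  by exists x; rewrite // inE xV -yE.
rewrite big_imset_cond // => M N; rewrite !powersetE => sM sN eqMN.
by apply: imset_inj_sub eqMN; apply: subset_trans sVX.
Qed.

Lemma imset_setD V M : V \subset X -> M \subset V -> f @: (V :\: M) = f @: V :\: f @: M.
Proof.
move=> sVX sMV; apply/setP => y; rewrite in_setD.
apply/imsetP/andP => [[x /setDP[xV xM] ->]|[yM /imsetP[x xV yE]]].
  split; last exact: imset_f.
  by rewrite mem_imset_sub ?(subsetP sVX) // (subset_trans sMV).
by exists x; rewrite // inE xV andbT; apply: contra yM => xM; rewrite yE imset_f.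
Qed.

Lemma imset_minelts V : V \subset X -> minelts r' (f @: V) = f @: minelts r V.
Proof.
move=> /subsetP sVX; apply/setP => y; apply/mineltsP/imsetP => [[/imsetP[x xV ->] miny]|].
  exists x => //; apply/mineltsP; split=> // z zV.
  by rewrite -f_mono ?sVX //; apply: miny; apply: imset_f.
case=> x /mineltsP[xV minx] ->; split; first exact: imset_f.
by move=> _ /imsetP[z zV ->]; rewrite f_mono ?sVX //; apply: minx.
Qed.

Lemma layerings_imset k V : V \subset X -> layerings r' k (f @: V) = layerings r k V.
Proof.
elim: k V => [|k IH] V sVX /=; first by rewrite imset_eq0.
have smX : minelts r V \subset X := subset_trans (minelts_sub r V) sVX.
rewrite imset_minelts // big_powerset_imset //; apply: eq_big => [M|M].
  by rewrite imset_eq0.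
rewrite powersetE => /andP[sM _]; have sMV := subset_trans sM (minelts_sub r V).
by rewrite -imset_setD // IH // subDset subsetU // sVX orbT.
Qed.

Lemma hook_weight_imset (K : fieldType) V : V \subset X ->
  hook_weight K r' (f @: V) = hook_weight K r V.
Proof.
move=> sVX; have f_injV := sub_in2 (subsetP sVX) f_inj.
rewrite /hook_weight big_imset //; apply: eq_bigr => x xV; congr (_%:R^-1).
rewrite -(@card_in_imset _ _ f); last first.
  by apply: sub_in2 f_injV; apply: (subsetP (up_sub r V x)).
apply: eq_card => y; rewrite inE; apply/andP/imsetP => [[/imsetP[z zV ->]]|[z]].
  rewrite (inj_in_eq f_injV) // f_mono ?(subsetP sVX) // => zx.
  by exists z; rewrite // inE zV.
rewrite inE => /andP[zV zx] ->.
by rewrite imset_f // (inj_in_eq f_injV) // f_mono ?(subsetP sVX).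
Qed.

End OrderEmbedding.

(** * Relabelling the points *)

Lemma sorted_enum_ord n (X : {pred 'I_n}) :
  sorted (fun i j : 'I_n => (i < j)%N) (enum X).
Proof.
have ltnt : transitive (fun i j : 'I_n => (i < j)%N) by move=> ? ? ?; apply: ltn_trans.
rewrite /enum_mem sorted_filter // -enumT.
have := iota_ltn_sorted 0 n; rewrite -val_enum_ord sorted_map.
by apply: etrans; apply: eq_sorted.
Qed.

Section Relabelling.

Variables (m n : nat) (e : 'I_m -> 'I_n).
Hypothesis e_homo : forall i j : 'I_m, (i < j)%N -> (e i < e j)%N.
Implicit Types (B C : {set 'I_m}) (P : {set {set 'I_m}}).

Lemma relabel_mono (i j : 'I_m) : (e i < e j)%N = (i < j)%N.
Proof.
case: (ltngtP i j) => [/e_homo ->//|/e_homo lt_ji|/val_inj ->]; last by rewrite ltnn.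
by rewrite ltnNge ltnW.
Qed.

Lemma relabel_inj : injective e.
Proof.
move=> i j eqij; apply: val_inj.
by case: (ltngtP i j) => // /e_homo; rewrite eqij ltnn.
Qed.

Lemma enum_relabel B : [seq e i | i <- enum B] = enum (e @: B).
Proof.
apply: (@irr_sorted_eq _ (fun i j : 'I_n => (i < j)%N)).
- by move=> ? ? ?; apply: ltn_trans.
- by move=> i; rewrite ltnn.
- rewrite sorted_map; apply: etrans (sorted_enum_ord (mem B)).
  by apply: eq_sorted => i j; apply: relabel_mono.
- exact: sorted_enum_ord.
move=> x; rewrite mem_enum; apply/mapP/imsetP => -[i iB ->]; exists i => //.
  by rewrite mem_enum in iB.
by rewrite mem_enum.
Qed.

Lemma nested_relabel B C : nested (e @: B) (e @: C) = nested B C.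
Proof.
apply/nestedP/nestedP.
  move=> [_ [_ [/imsetP[x xB ->] /imsetP[y yB ->] h]]]; exists x, y; split=> // z zC.
  by have := h (e z) (imset_f e zC); rewrite !relabel_mono.
move=> [x [y [xB yB h]]]; exists (e x), (e y); split; rewrite ?imset_f //.
by move=> _ /imsetP[z zC ->]; rewrite !relabel_mono h.
Qed.

Definition relabel P := (fun B => e @: B) @: P.

Lemma noncrossing_relabel P : noncrossing (relabel P) = noncrossing P.
Proof.
apply/noncrossingP/noncrossingP => nc.
  move=> B C i j k l BP CP BC iB jC kB lC ij jk kl.
  have BC' : e @: B != e @: C by rewrite (inj_eq (imset_inj relabel_inj)).
  apply: (nc _ _ _ _ _ _ (imset_f _ BP) (imset_f _ CP) BC' (imset_f e iB)
    (imset_f e jC) (imset_f e kB) (imset_f e lC)); exact: e_homo.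
move=> _ _ i j k l /imsetP[B BP ->] /imsetP[C CP ->].
rewrite (inj_eq (imset_inj relabel_inj)) => BC.
move=> /imsetP[{}i iB ->] /imsetP[{}j jC ->] /imsetP[{}k kB ->] /imsetP[{}l lC ->].
by rewrite !relabel_mono; apply: nc BP CP BC iB jC kB lC.
Qed.

Lemma ncp_relabel : ncp (e @: setT) = relabel @: NC m.
Proof.
apply/setP => Q; apply/idP/imsetP => [|[P]]; last first.
  rewrite !inE => /andP[partP ncP] ->.
  by rewrite noncrossing_relabel ncP (imset_partition _ _ relabel_inj) partP.
rewrite inE => /andP[partQ ncQ].
have QE : Q = relabel ((fun B : {set 'I_n} => e @^-1: B) @: Q).
  rewrite /relabel -imset_comp -{1}[Q]imset_id; apply: eq_in_imset => B BQ /=.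
  apply/setP => x; apply/idP/imsetP => [xB|[i]]; last by rewrite inE => ? ->.
  have /imsetP[i _ xE] : x \in e @: setT.
    by have [_ cQ _] := (partition_iff _ _).1 partQ; apply/cQ; exists B.
  by exists i; rewrite // inE -xE.
exists ((fun B : {set 'I_n} => e @^-1: B) @: Q) => //; move: partQ ncQ.
by rewrite {1 2}QE (imset_partition _ _ relabel_inj) noncrossing_relabel !inE => -> ->.
Qed.

Lemma relabel_block_inj P : {in P &, injective (fun B => e @: B)}.
Proof. by move=> B C _ _; apply: imset_inj relabel_inj _ _. Qed.

Lemma sum_ncp_relabel (R : nmodType) (F : {set {set 'I_n}} -> R) :
  \sum_(Q in ncp (e @: setT)) F Q = \sum_(P in NC m) F (relabel P).
Proof.
rewrite ncp_relabel big_imset // => P Q _ _.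
exact: imset_inj (imset_inj relabel_inj) _ _.
Qed.

Lemma prod_relabel (R : comPzRingType) P (k : {set 'I_n} -> R) :
  \prod_(B in relabel P) k B = \prod_(B in P) k (e @: B).
Proof. by rewrite big_imset //; apply: relabel_block_inj. Qed.

Lemma hook_weight_relabel (K : fieldType) P :
  hook_weight K (@nested n) (relabel P) = hook_weight K (@nested m) P.
Proof.
apply: hook_weight_imset (subxx P); first exact: relabel_block_inj.
by move=> B C _ _; apply: nested_relabel.
Qed.

Lemma subword_relabel (T : Type) (a : n.-tuple T) B :
  subword [tuple tnth a (e i) | i < m] B = subword a (e @: B).
Proof.
rewrite /subword -enum_relabel -map_comp; apply: eq_map => i /=.
by rewrite tnth_mktuple.
Qed.

End Relabelling.

Lemma enum_val_homo n (X : {set 'I_n}) (i j : 'I_#|X|) :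
  (i < j)%N -> (enum_val i < enum_val j)%N.
Proof.
move=> ij; have x0 := enum_val i; rewrite !(enum_val_nth x0).
apply: (sorted_ltn_nth (leT := fun i j : 'I_n => (i < j)%N)) => //.
- by move=> ? ? ?; apply: ltn_trans.
- exact: sorted_enum_ord.
- by rewrite inE -cardE.
- by rewrite inE -cardE.
Qed.

Lemma imset_enum_val (T : finType) (X : {set T}) :
  (fun i : 'I_#|X| => enum_val i) @: setT = X.
Proof.
apply/setP => x; apply/imsetP/idP => [[i _ ->]|xX]; first exact: enum_valP.
by exists (enum_rank_in xX x); rewrite ?enum_rankK_in.
Qed.

(** * The tree factorial as a hook product *)

Section TreeFactorial.

(** Below every element of a forest there is exactly one minimal element. *)
Lemma big_forest_roots (R : Type) (idx : R) (op : Monoid.com_law idx)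
    (T : finType) (r : rel T) (V : {set T}) (F : T -> R) :
  irreflexive r -> transitive r -> forest r V ->
  \big[op/idx]_(x in V) F x =
  \big[op/idx]_(x in minelts r V) \big[op/idx]_(y in up r V x) F y.
Proof.
move=> r_irr r_trans fV; rewrite (exchange_big_dep (fun y => y \in V)) /=; last first.
  by move=> x y _; apply: (subsetP (up_sub r V x)).
apply: eq_bigr => y yV.
(* The elements below y are pairwise comparable, so a minimal one is unique. *)
pose below := [set x in V | y \in up r V x].
have /set0Pn[x /mineltsP[]] : minelts r below != set0.
  by apply: minelts_neq0 => //; apply/set0Pn; exists y; rewrite !inE yV eqxx.
rewrite inE => /andP[xV yx] minx; rewrite (big_pred1 x) // => z.
apply/andP/eqP => [[/mineltsP[zV minz] yz]|->]; last first.
  split=> //; apply/mineltsP; split=> // t tV; apply/negP => rtx.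
  suff tb : t \in below by have := minx t tb; rewrite rtx.
  move: yx; rewrite !inE tV yV => /predU1P[->|rxy]; first by rewrite rtx orbT.
  by rewrite (r_trans _ _ _ rtx rxy) orbT.
have cmp : [|| z == x, r z x | r x z].
  move: yx yz; rewrite !inE yV => /predU1P[yx|rxy] /predU1P[yz|rzy].
  - by rewrite -yx -yz eqxx.
  - by rewrite -yx rzy orbT.
  - by rewrite -yz rxy !orbT.
  - exact: fV rzy rxy.
case/or3P: cmp => [/eqP //|rzx|rxz].
  by have := minx z; rewrite inE zV yz rzx => /(_ isT).
by have := minz x xV; rewrite rxz.
Qed.

Variables (n : nat) (P : {set {set 'I_n}}).
Hypothesis fP : forest (@nested n) P.
Implicit Types B C D : {set 'I_n}.

Let above B := [set C in P | nested B C].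

Lemma up_above B C : C \in above B -> up (@nested n) (above B) C = up (@nested n) P C.
Proof.
rewrite inE => /andP[CP BC]; apply/setP => D; rewrite !inE.
case: (boolP (D \in P)) => //= DP; case: eqP => [->|_]; first by rewrite BC.
by case: (boolP (nested C D)) => [/(nested_trans BC)->|_]; rewrite ?andbF.
Qed.

Lemma children_minelts B :
  [set C in P | covers P B C] = minelts (@nested n) (above B).
Proof.
apply/setP => C; rewrite inE; apply/andP/mineltsP.
  move=> [CP /andP[BC /exists_inPn minC]]; rewrite inE CP BC; split=> // D.
  by rewrite inE => /andP[DP BD]; have := minC D DP; rewrite BD.
rewrite inE => -[/andP[-> BC] minC]; rewrite /covers BC; split=> //=.
apply/exists_inPn => D DP; apply/negP => /andP[BD DC].
by have := minC D; rewrite inE DP BD DC => /(_ isT).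
Qed.

Lemma outer_minelts : [set B in P | outer P B] = minelts (@nested n) P.
Proof.
apply/setP => B; rewrite inE; apply/andP/mineltsP => -[BP h]; split=> //.
  by move/exists_inPn: h.
exact/exists_inPn.
Qed.

Lemma up_setU1 B : B \in P -> up (@nested n) P B = B |: above B.
Proof.
move=> BP; apply/setP => C; rewrite !inE andb_orr; congr (_ || _).
by case: eqP => [->|]; rewrite ?BP // andbF.
Qed.

Lemma notin_above B : B \notin above B.
Proof. by rewrite inE nested_irr andbF. Qed.

Lemma forest_above B : forest (@nested n) (above B).
Proof. by apply: forest_sub fP; apply/subsetP => C; rewrite inE => /andP[]. Qed.

Lemma big_children (R : Type) (idx : R) (op : Monoid.com_law idx) B (F : {set 'I_n} -> R) :
  \big[op/idx]_(C in above B) F C =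
  \big[op/idx]_(C in [set C in P | covers P B C])
     \big[op/idx]_(D in up (@nested n) P C) F D.
Proof.
rewrite (big_forest_roots op F (@nested_irr n) (@nested_trans n) (@forest_above B)).
rewrite children_minelts; apply: eq_bigr => C /(subsetP (minelts_sub _ _)) CB.
by rewrite up_above.
Qed.

(** Both recursions follow from [big_children]: the blocks strictly above B are
    distributed over the subtrees of its children. *)
Lemma block_treeE fuel B : B \in P -> (#|up (@nested n) P B| <= fuel)%N ->
  tree_size (block_tree P fuel B) = #|up (@nested n) P B| /\
  tree_fact (block_tree P fuel B) =
    (\prod_(C in up (@nested n) P B) #|up (@nested n) P C|)%N.
Proof.
elim: fuel B => [|fuel IH] B BP.
  by rewrite leqn0 cards_eq0 => /eqP U0; have := mem_up (@nested n) BP; rewrite U0 inE.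
rewrite {1}up_setU1 // cardsU1 notin_above add1n ltnS => le_fuel.
have IHB C : C \in [set C in P | covers P B C] ->
    tree_size (block_tree P fuel C) = #|up (@nested n) P C| /\
    tree_fact (block_tree P fuel C) =
      (\prod_(D in up (@nested n) P C) #|up (@nested n) P D|)%N.
  rewrite inE => /andP[CP /andP[BC _]]; apply: IH => //; apply: leq_trans le_fuel.
  apply/subset_leq_card/subsetP => D; rewrite !inE => /andP[DP /predU1P[->|CD]].
    by rewrite CP BC.
  by rewrite DP (nested_trans BC CD).
have sizeE : tree_size (block_tree P fuel.+1 B) = #|up (@nested n) P B|.
  rewrite up_setU1 // cardsU1 notin_above add1n /= !big_map big_enum /=; congr _.+1.
  rewrite -sum1_card big_children; apply: eq_bigr => C /IHB[-> _].
  by rewrite sum1_card.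
split=> //.
rewrite -[LHS]/(tree_size (block_tree P fuel.+1 B) * \prod_(k <- [seq tree_fact u
  | u <- [seq block_tree P fuel C | C <- enum [set C in P | covers P B C]]]) k)%N.
rewrite sizeE !big_map big_enum [in RHS]up_setU1 // big_setU1 ?notin_above //=.
by rewrite big_children; congr (_ * _)%N; apply: eq_bigr => C /IHB[].
Qed.

Lemma forest_factE :
  forest_fact (nesting_forest P) = (\prod_(B in P) #|up (@nested n) P B|)%N.
Proof.
rewrite /forest_fact big_map big_enum /= outer_minelts.
rewrite (big_forest_roots _ _ (@nested_irr n) (@nested_trans n) fP).
apply: eq_bigr => B /mineltsP[BP _].
by case: (@block_treeE #|P| B) => //; apply/subset_leq_card/up_sub.
Qed.

End TreeFactorial.

Lemma forest_fact_hook_weight (K : fieldType) n (P : {set {set 'I_n}}) :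
  P \in NC n -> (forest_fact (nesting_forest P))%:R^-1 = hook_weight K (@nested n) P.
Proof. by move=> /ncp_forest/forest_factE ->; rewrite natr_prod -prodfV. Qed.

(** * Quasi-orders and layerings *)

Section QuasiOrders.

Variable n : nat.
Local Notation block := {set 'I_n}.
Implicit Types (B C D : block) (V M : {set block}) (R S : {set block * block}).

Lemma total_quasi_orderP V R :
  reflect [/\ forall B C, (B, C) \in R -> B \in V /\ C \in V,
              forall B, B \in V -> (B, B) \in R,
              forall B C D, (B, C) \in R -> (C, D) \in R -> (B, D) \in R
            & forall B C, B \in V -> C \in V -> (B, C) \in R \/ (C, B) \in R]
          (total_quasi_order V R).
Proof.
apply: (iffP and4P) => -[h1 h2 h3 h4].
  have sR B C : (B, C) \in R -> B \in V /\ C \in V.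
    by move/(subsetP h1); rewrite inE => /andP.
  split=> // [B BV|B C D BC CD|B C BV CV]; first exact: (forall_inP h2).
    have [[BV CV] [_ DV]] := (sR _ _ BC, sR _ _ CD).
    move/forall_inP/(_ B BV)/forall_inP/(_ C CV)/forall_inP/(_ D DV)/implyP: h3.
    by rewrite BC CD; apply.
  by apply/orP; move/forall_inP/(_ B BV)/forall_inP/(_ C CV): h4.
split.
- by apply/subsetP => -[B C] /h1[BV CV]; rewrite inE BV.
- by apply/forall_inP.
- apply/forall_inP => B _; apply/forall_inP => C _; apply/forall_inP => D _.
  by apply/implyP => /andP[]; apply: h3.
- apply/forall_inP => B BV; apply/forall_inP => C CV; apply/orP; exact: h4.
Qed.

Lemma strictly_extendsP V R :
  reflect (forall B C, B \in V -> C \in V -> nested B C ->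
             (B, C) \in R /\ (C, B) \notin R)
          (strictly_extends_nesting V R).
Proof.
apply: (iffP forall_inP) => [h B C BV CV BC|h B BV].
  by apply/andP; move/forall_inP/(_ C CV)/implyP: (h B BV); apply.
by apply/forall_inP => C CV; apply/implyP => /(h _ _ BV CV) /andP.
Qed.

Definition least_class V R := [set B in V | [forall C in V, (B, C) \in R]].

Lemma least_classP V R B :
  reflect (B \in V /\ forall C, C \in V -> (B, C) \in R) (B \in least_class V R).
Proof.
by rewrite inE; apply: (iffP andP) => -[BV h]; split=> //; apply/forall_inP.
Qed.

Lemma least_class_neq0 V R : total_quasi_order V R -> V != set0 ->
  least_class V R != set0.
Proof.
case/total_quasi_orderP => sR rfl tr tot /set0Pn[B0 B0V].
(* An element with the most successors is below all others. *)
case: (arg_maxnP (fun B => #|[set C in V | (B, C) \in R]|) B0V) => B BV Bmax.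
apply/set0Pn; exists B; apply/least_classP; split=> // C CV.
apply: contraT => BC; have CB : (C, B) \in R by case: (tot B C BV CV) BC => [->|].
have : (#|[set D in V | (C, D) \in R]| <= #|[set D in V | (B, D) \in R]|)%N := Bmax C CV.
rewrite leqNgt => /negP[]; apply: proper_card.
apply/properP; split.
  by apply/subsetP => D; rewrite !inE => /andP[-> BD]; apply: tr CB BD.
by exists C; rewrite !inE CV ?rfl.
Qed.

Lemma least_class_minelts V R : strictly_extends_nesting V R ->
  least_class V R \subset minelts (@nested n) V.
Proof.
move/strictly_extendsP => ext; apply/subsetP => B /least_classP[BV leB].
apply/mineltsP; split=> // C CV; apply/negP => CB.
by have [_] := ext C B CV BV CB; rewrite leB.
Qed.

Definition add_least V M S := S :|: setX M V.

Definition drop_least V M R := R :&: setX (V :\: M) (V :\: M).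

Lemma mem_add_least V M S B C :
  ((B, C) \in add_least V M S) = ((B, C) \in S) || (B \in M) && (C \in V).
Proof. by rewrite !inE. Qed.

Lemma mem_drop_least V M R B C :
  ((B, C) \in drop_least V M R) =
  [&& (B, C) \in R, B \in V :\: M & C \in V :\: M].
Proof. by rewrite !inE. Qed.

Section LeastClass.

Variables (V M : {set block}).
Hypotheses (sMV : M \subset V) (M0 : M != set0).

Section Drop.

Variable R : {set block * block}.
Hypotheses (tqoR : total_quasi_order V R) (leastR : least_class V R = M).

Lemma least_below B C : B \in M -> C \in V -> (B, C) \in R.
Proof. by rewrite -leastR => /least_classP[_ h] /h. Qed.

Lemma not_below_least B C : B \notin M -> C \in M -> (B, C) \notin R.
Proof.
move=> BM CM; apply: contra BM => BC; rewrite -leastR.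
have /total_quasi_orderP[sR _ tr _] := tqoR.
apply/least_classP; split=> [|D DV]; first by case: (sR _ _ BC).
exact: tr BC (least_below CM DV).
Qed.

Lemma drop_leastK : add_least V M (drop_least V M R) = R.
Proof.
have /total_quasi_orderP[sR _ _ _] := tqoR.
apply/setP => -[B C]; rewrite mem_add_least mem_drop_least !in_setD.
have [BM|BM] := boolP (B \in M) => /=.
  rewrite andbF /=; apply/idP/idP => [CV|/sR[]//]; exact: least_below.
have [CM|CM] := boolP (C \in M); rewrite ?orbF /= ?andbF.
  by apply/esym/negbTE; apply: not_below_least.
by case: (boolP (_ \in R)) => //= /sR[-> ->].
Qed.

Lemma total_quasi_order_drop : total_quasi_order (V :\: M) (drop_least V M R).
Proof.
have /total_quasi_orderP[sR rfl tr tot] := tqoR; apply/total_quasi_orderP; split.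
- by move=> B C; rewrite mem_drop_least => /and3P[].
- by move=> B BV; rewrite mem_drop_least BV rfl //; case/setDP: BV.
- move=> B C D; rewrite !mem_drop_least => /and3P[BC BV _] /and3P[CD _ DV].
  by rewrite BV DV (tr _ _ _ BC CD).
- move=> B C BV CV; rewrite !mem_drop_least BV CV !andbT.
  by apply: tot; [case/setDP: BV|case/setDP: CV].
Qed.

Lemma strictly_extends_drop : strictly_extends_nesting V R ->
  strictly_extends_nesting (V :\: M) (drop_least V M R).
Proof.
move/strictly_extendsP => ext; apply/strictly_extendsP => B C BV CV BC.
have [BC1 BC2] := ext B C (subsetP (subsetDl V M) B BV) (subsetP (subsetDl V M) C CV) BC.
by rewrite !mem_drop_least BC1 BV CV (negPf BC2).
Qed.

(** Away from the least class M nothing changes, and M is one more class. *)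
Lemma classes_drop : #|quasi_order_classes V R| =
  #|quasi_order_classes (V :\: M) (drop_least V M R)|.+1.
Proof.
set cl := quasi_order_classes _ (drop_least V M R).
suff -> : quasi_order_classes V R = M |: cl.
  rewrite cardsU1 (_ : M \notin cl) //; apply/negP => /imsetP[B _ ME].
  case/set0Pn: M0 => C CM; have := CM; rewrite ME inE => /andP[/setDP[_]].
  by rewrite CM.
have classM B : B \in M -> [set C in V | ((B, C) \in R) && ((C, B) \in R)] = M.
  move=> BM; apply/setP => C; rewrite inE.
  have [CM|CM] := boolP (C \in M).
    by rewrite (subsetP sMV) // !least_below // (subsetP sMV).
  by rewrite (negPf (not_below_least CM BM)) !andbF.
have classD B : B \in V :\: M -> [set C in V | ((B, C) \in R) && ((C, B) \in R)] =
    [set C in V :\: M | ((B, C) \in drop_least V M R) && ((C, B) \in drop_least V M R)].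
  move=> BD; have /setDP[BV BM] := BD; apply/setP => C.
  rewrite [LHS]in_set [RHS]in_set !mem_drop_least BD.
  have [CM|CM] := boolP (C \in M) => /=; last first.
    by rewrite !in_setD CM; case: (C \in V); rewrite ?andbF ?andbT.
  by rewrite (negPf (not_below_least BM CM)) !in_setD CM !andbF.
apply/setP => c; apply/imsetP/setU1P.
  case=> B BV ->; have [BM|BM] := boolP (B \in M); [left; exact: classM|right].
  have BD : B \in V :\: M by rewrite inE BM.
  by apply/imsetP; exists B => //; apply: classD.
case=> [->|/imsetP[B BD ->]].
  by case/set0Pn: M0 => B BM; exists B; rewrite ?classM // (subsetP sMV).
by exists B; rewrite ?classD //; case/setDP: BD.
Qed.

End Drop.

Section Add.

Variable S : {set block * block}.
Hypothesis tqoS : total_quasi_order (V :\: M) S.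

Lemma add_least_sub B C : (B, C) \in S -> [/\ B \in V, C \in V, B \notin M & C \notin M].
Proof.
by have /total_quasi_orderP[sS _ _ _] := tqoS => /sS[/setDP[? ?] /setDP[? ?]].
Qed.

Lemma add_leastK : drop_least V M (add_least V M S) = S.
Proof.
apply/setP => -[B C]; rewrite mem_drop_least mem_add_least !in_setD.
have [BC|BC] := boolP (_ \in S); first by have [-> -> -> ->] := add_least_sub BC.
by case: (B \in M); rewrite ?andbF.
Qed.

Lemma total_quasi_order_add : total_quasi_order V (add_least V M S).
Proof.
have /total_quasi_orderP[sS rfl tr tot] := tqoS; apply/total_quasi_orderP; split.
- move=> B C; rewrite mem_add_least => /orP[/add_least_sub[]//|/andP[BM CV]].
  by split=> //; apply: (subsetP sMV).
- move=> B BV; rewrite mem_add_least BV andbT.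
  by have [BM|BM] := boolP (B \in M); rewrite ?orbT // rfl // inE BM.
- move=> B C D; rewrite !mem_add_least.
  case/orP=> [BC|/andP[BM CV]]; case/orP=> [CD|/andP[CM DV]].
  + by rewrite (tr _ _ _ BC CD).
  + by have [_ _ _] := add_least_sub BC; rewrite CM.
  + by have [_ DV _ _] := add_least_sub CD; rewrite BM DV orbT.
  + by rewrite BM DV orbT.
- move=> B C BV CV; rewrite !mem_add_least BV CV !andbT.
  have [BM|BM] := boolP (B \in M); first by left; rewrite orbT.
  have [CM|CM] := boolP (C \in M); first by right; rewrite orbT.
  by rewrite !orbF; apply: tot; rewrite inE ?BM ?CM.
Qed.

Lemma least_class_add : least_class V (add_least V M S) = M.
Proof.
apply/setP => B; apply/least_classP/idP => [[BV leB]|BM].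
  case/set0Pn: M0 => C CM; have := leB C (subsetP sMV C CM).
  rewrite mem_add_least => /orP[/add_least_sub[_ _ _]|/andP[//]].
  by rewrite CM.
by split=> [|C CV]; rewrite ?mem_add_least ?BM ?CV ?orbT // (subsetP sMV).
Qed.

Lemma strictly_extends_add : M \subset minelts (@nested n) V ->
  strictly_extends_nesting (V :\: M) S ->
  strictly_extends_nesting V (add_least V M S).
Proof.
move=> /subsetP sM /strictly_extendsP ext; apply/strictly_extendsP => B C BV CV BC.
have CM : C \notin M by apply: contraL BC => /sM/mineltsP[_ ->].
rewrite !mem_add_least (negPf CM) orbF CV andbT.
have [BM|BM] := boolP (B \in M); last first.
  by rewrite orbF; apply: ext BC; rewrite inE ?BM ?CM.
rewrite orbT; split=> //; apply/negP => /add_least_sub[_ _ _].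
by rewrite BM.
Qed.

End Add.

End LeastClass.

(** A total quasi-order amounts to its least class and its restriction to the other
    blocks; the least class can be any nonempty set of minimal blocks. This is
    the recursion that defines [layerings]. *)
Lemma omega_layerings k V : omega_ k V = layerings (@nested n) k V.
Proof.
elim: k V => [|k IH] V.
  rewrite /omega_ /=; have [->|V0] := eqVneq V set0.
    rewrite (_ : [set R | _] = [set set0]) ?cards1 //.
    apply/setP => R; rewrite !inE.
    apply/and3P/eqP => [[/total_quasi_orderP[sR _ _ _] _ _]|->].
      by apply/setP => -[B C]; rewrite inE; apply/negP => /sR[]; rewrite inE.
    split.
    - by apply/total_quasi_orderP; split=> [B C|B|B C D|B C]; rewrite inE.
    - by rewrite cards_eq0 /quasi_order_classes /equivalence_partition imset0.
    - by apply/strictly_extendsP => B C; rewrite inE.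
  apply/eqP; rewrite cards_eq0 -subset0; apply/subsetP => R; rewrite !inE.
  case/and3P=> _; rewrite cards_eq0 => /eqP cl0 _.
  case/set0Pn: V0 => B BV.
  suff : [set C in V | ((B, C) \in R) && ((C, B) \in R)] \in quasi_order_classes V R.
    by rewrite cl0 inE.
  by apply/imsetP; exists B.
rewrite /omega_ -sum1_card /=.
rewrite (partition_big (least_class V)
  (fun M => (M \in powerset (minelts (@nested n) V)) && (M != set0))) /=; last first.
  move=> R; rewrite inE => /and3P[tqo /eqP cl ext].
  rewrite powersetE least_class_minelts // least_class_neq0 //.
  apply/eqP => V0; move: cl; rewrite V0 /quasi_order_classes /equivalence_partition imset0.
  by rewrite cards0.
apply: eq_bigr => M; rewrite powersetE => /andP[sM M0]; rewrite -IH /omega_ -sum1_card.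
have sMV := subset_trans sM (minelts_sub _ _).
rewrite (reindex_onto (add_least V M) (drop_least V M)) /=; last first.
  by move=> R; rewrite !inE => /andP[/and3P[tqo _ _] /eqP least]; apply: drop_leastK.
apply: eq_bigl => S; rewrite !inE; apply/andP/and3P.
  case=> /andP[/and3P[tqo /eqP cl ext] /eqP least] /eqP SE; rewrite -SE; split.
  - exact: total_quasi_order_drop.
  - by move: cl; rewrite (classes_drop sMV M0 tqo least) => /eqP.
  - exact: strictly_extends_drop.
case=> tqo /eqP cl ext.
have tqo' := total_quasi_order_add sMV tqo.
have least' := least_class_add sMV M0 tqo.
rewrite tqo' least' add_leastK // strictly_extends_add // !eqxx andbT /=; split=> //.
by rewrite (classes_drop sMV M0 tqo' least') add_leastK // cl eqxx.
Qed.

End QuasiOrders.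

(** * Irreducible partitions and the coefficients omega *)

(** A block that contains the first and the last point is below every other block;
    conversely no block contains points on both sides of the first or of the
    last point, so these can only lie in the least block. *)
Lemma NCirr_nctree m : (0 < m)%N -> NCirr m = nctree [set: 'I_m].
Proof.
move=> m_gt0; apply/setP => P; rewrite [LHS]in_set [RHS]in_set.
apply: andb_id2l => PX; have := PX; rewrite inE => /andP[/partition_iff[_ cP tP] _].
rewrite /irreducible_partition; apply/exists_inP/treeP => -[B BP]; last first.
  move=> root.
  have inB (i : 'I_m) : (forall x y : 'I_m, (x < i < y)%N -> False) -> i \in B.
    move=> extremal; have /cP[C CP iC] := in_setT i.
    case: (root C CP) => [<-//|/nestedP[x [y [_ _ /(_ i iC)/extremal]]]].
    by [].
  have ltm : (m.-1 < m)%N by rewrite prednK.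
  exists B => //; apply/exists_inP; exists (Ordinal m_gt0).
    by apply: inB => x y; rewrite ltn0.
  apply/exists_inP; exists (Ordinal ltm); last by rewrite /= prednK.
  apply: inB => x y /andP[_ /=]; rewrite ltnNge -ltnS prednK ?ltn_ord //.
move=> /exists_inP[i iB /exists_inP[j jB /andP[/eqP i0 /eqP jm]]]; exists B => // C CP.
have [->|CB] := eqVneq C B; [by left | right].
apply/nestedP; exists i, j; split=> // z zC.
have neqz x : x \in B -> z != x.
  by move=> xB; apply: contraNneq CB => zx; rewrite (tP C B z) // zx.
have := neqz i iB; have := neqz j jB; rewrite -!val_eqE /= i0 => zj z0.
by rewrite lt0n z0 ltn_neqAle zj -ltnS jm ltn_ord.
Qed.

Section Isomorphism.

Variables (n n' : nat) (P : {set {set 'I_n}}) (Q : {set {set 'I_n'}}).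
Variable f : {set 'I_n} -> {set 'I_n'}.
Hypotheses (f_inj : {in P &, injective f}) (fP : f @: P = Q).
Hypothesis f_covers : {in P &, forall B C, covers Q (f B) (f C) = covers P B C}.

(** The nesting order is the transitive closure of its covering relation: split at
    an intermediate block, and count the blocks in between. *)
Lemma nested_covers_ind m (W : {set {set 'I_m}}) (S : {set 'I_m} -> {set 'I_m} -> Prop) :
  (forall B C D, B \in W -> C \in W -> D \in W -> S B C -> S C D -> S B D) ->
  (forall B C, B \in W -> C \in W -> covers W B C -> S B C) ->
  forall B C, B \in W -> C \in W -> nested B C -> S B C.
Proof.
move=> Strans Scov B C.
pose between B C := [set D in W | nested B D && nested D C].
have [k] := ubnP #|between B C|; elim: k B C => // k IH B C; rewrite ltnS => lt_k BW CW BC.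
case: (boolP (covers W B C)) => [/Scov|]; first exact.
rewrite /covers BC negbK => /exists_inP[D DW /andP[BD DC]].
have Dbet : D \in between B C by rewrite inE DW BD.
apply: (Strans B D C) => //; apply: IH => //; apply: leq_trans lt_k; apply: proper_card.
  apply/properP; split; last by exists D; rewrite // inE nested_irr !andbF.
  apply/subsetP => E; rewrite !inE => /and3P[-> -> ED]; exact: nested_trans ED DC.
apply/properP; split; last by exists D; rewrite // inE nested_irr !andbF.
by apply/subsetP => E; rewrite !inE => /and3P[-> DE ->]; rewrite (nested_trans BD DE).
Qed.

(** Two applications of [nested_covers_ind], to the image under f and, on Q, to the
    relation carried over from P. *)
Lemma nested_iso : {in P &, {mono f : B C / nested B C >-> nested B C}}.
Proof.
have fQ B : B \in P -> f B \in Q by move=> BP; rewrite -fP imset_f.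
move=> B C BP CP; apply/idP/idP; last first.
  apply: (nested_covers_ind (S := fun B C => nested (f B) (f C))) BP CP => {B C}.
    by move=> B C D _ _ _; apply: nested_trans.
  move=> B C BP CP.
  by rewrite -f_covers // => /andP[].
pose S B' C' := forall B C, B \in P -> C \in P -> f B = B' -> f C = C' -> nested B C.
suff SQ B' C' : B' \in Q -> C' \in Q -> nested B' C' -> S B' C'.
  by move=> nBC; apply: (SQ (f B) (f C)); rewrite ?fQ.
move: B' C'; apply: (nested_covers_ind (S := S)) => [B' C' D' _|B' C' _ _ cBC]; last first.
  move=> {BP CP}B {}C BP CP EB EC.
  by move: cBC; rewrite -EB -EC f_covers // => /andP[].
rewrite -{1}fP => /imsetP[E EP EE] _ SBC SCD B1 D BP1 DP EB ED.
by apply: (@nested_trans _ E); [apply: SBC | apply: SCD].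
Qed.

Lemma layerings_iso k : layerings (@nested n') k Q = layerings (@nested n) k P.
Proof. by rewrite -fP; apply: (layerings_imset f_inj nested_iso k (subxx P)). Qed.

End Isomorphism.

Lemma sum_nat_trunc (R : nmodType) (F : nat -> R) c N : (c <= N)%N ->
  (forall k, (c <= k)%N -> F k = 0) -> \sum_(0 <= k < N) F k = \sum_(0 <= k < c) F k.
Proof.
move=> cN F0; rewrite (big_cat_nat (leq0n c) cN) /= [X in _ + X]big_nat_cond.
rewrite [X in _ + X]big1 ?addr0 // => k.
by rewrite andbT => /andP[ck _]; apply: F0.
Qed.

Lemma card_partition_leq n (P : {set {set 'I_n}}) : P \in NC n -> (#|P| <= n)%N.
Proof.
move=> PX; have := PX; rewrite !inE => /andP[partP _].
rewrite -[X in (_ <= X)%N]card_ord -cardsT (card_partition partP) -sum1_card.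
by apply: leq_sum => B BP; rewrite card_gt0; apply/set0Pn; apply: ncp_neq0 PX BP.
Qed.

Lemma omegaE n (P : {set {set 'I_n}}) : P \in NC n ->
  omega P = \sum_(0 <= k < #|P|) (-1) ^+ k / k.+1%:R * (layerings (@nested n) k.+1 P)%:R.
Proof.
move=> PX; rewrite /omega big_add1 /= (sum_nat_trunc (card_partition_leq PX)).
  by apply: eq_bigr => k _; rewrite omega_layerings !exprS mulrA mulrNN !mul1r.
by move=> k lek; rewrite omega_layerings layerings_small ?mulr0.
Qed.

Lemma ratr_omega (K : fieldType) (charK : [pchar K] =i pred0) n (P : {set {set 'I_n}}) :
  P \in NC n -> ratr (omega P) = murua K (@nested n) P.
Proof.
move=> PX; pose w k := layerings (@nested n) k P.
have -> : omega P = \sum_(0 <= k < #|P|) ((-1) ^+ k * (w k.+1)%:Z)%:~R / (Posz k.+1)%:~R.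
  rewrite omegaE //; apply: eq_bigr => k _.
  by rewrite rmorphM rmorphXn rmorphN /= mulrAC.
rewrite (ratr_sum_frac charK) // /murua big_ord_recl.
rewrite {1}/log_coef invr0 mulr0 mul0r add0r.
rewrite -(big_mkord xpredT (fun k => log_coef K k.+1 * (w k.+1)%:R)).
rewrite (sum_nat_trunc (max_card P)).
  apply: eq_bigr => k _; rewrite rmorphM rmorphXn rmorphN /= mulrAC.
  by rewrite /log_coef !exprS mulrA mulrNN !mul1r.
by move=> k lek; rewrite /w layerings_small ?mulr0.
Qed.

(** * Comparison of the cumulants *)

Lemma subword_setT (T : Type) n (a : n.-tuple T) : subword a [set: 'I_n] = a.
Proof. by rewrite /subword enum_setT -enumT map_tnth_enum. Qed.

(** Only the one-block partition of X has a nonzero weight. *)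
Lemma nctree_sum_single (K : fieldType) n (k : {set 'I_n} -> K) X : X != set0 ->
  nctree_sum (fun P => (#|P| == 1%N)%:R) k X = k X.
Proof.
move=> X0; have X1 : [set X] \in nctree X.
  rewrite 2!inE -andbA; apply/and3P; split.
  - apply/partition_iff; split=> [|x|B C x]; first by rewrite inE eq_sym.
      by split=> [xX|[B /set1P ->//]]; exists X; rewrite ?set11.
    by move=> /set1P -> /set1P ->.
  - by apply/noncrossingP => B C i j k' l /set1P -> /set1P ->; rewrite eqxx.
  - by apply/treeP; exists X => [|B /set1P ->]; [exact: set11 | left].
rewrite /nctree_sum (bigD1 [set X]) //= cards1 mul1r big_set1 big1 ?addr0 // => P.
case/andP=> PX neqP1.
case: (boolP (#|P| == 1%N)) => [/cards1P[B PE]|]; last by rewrite mul0r.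
move: PX; rewrite 2!inE -andbA => /andP[/andP[/eqP covP _] _].
by case/eqP: neqP1; rewrite -covP PE cover1.
Qed.

Section CumulantRelations.

Variables (K : fieldType) (charK : [pchar K] =i pred0) (A : algType K).
Variables (phi : {scalar A}) (rho kappa : seq A -> K).
Hypotheses (rhoP : monotone_cumulants phi rho) (kappaP : free_cumulants phi kappa).

(** Both sides are the moment of the word a_X: the increasing enumeration of X
    carries the partitions of {0, ..., |X| - 1} to those of X. *)
Lemma moment_relation_subset n (a : n.-tuple A) (X : {set 'I_n}) : X != set0 ->
  \sum_(P in ncp X) hook_weight K (@nested n) P * \prod_(B in P) rho (subword a B) =
  \sum_(P in ncp X) \prod_(B in P) kappa (subword a B).
Proof.
move=> X0; pose e (i : 'I_#|X|) := enum_val i.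
have e_homo : forall i j : 'I_#|X|, (i < j)%N -> (e i < e j)%N := @enum_val_homo n X.
rewrite -(imset_enum_val X) !(sum_ncp_relabel e_homo).
pose b := [tuple tnth a (e i) | i < #|X|].
have X_gt0 : (0 < #|X|)%N by rewrite card_gt0.
transitivity (moment phi b).
  rewrite (rhoP.2 _ b X_gt0); apply: eq_bigr => P PX.
  rewrite (hook_weight_relabel e_homo) (prod_relabel e_homo) forest_fact_hook_weight //.
  by congr (_ * _); apply: eq_bigr => B _; rewrite (subword_relabel e_homo).
rewrite (kappaP.2 _ b X_gt0); apply: eq_bigr => P _; rewrite (prod_relabel e_homo).
by apply: eq_bigr => B _; rewrite (subword_relabel e_homo).
Qed.

(** The signs in k = - rho and k = - kappa make both polynomials equal to the moment
    at -1, where the order polynomials are known by reciprocity. *)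
Lemma monotone_from_free m (a : m.-tuple A) : (0 < m)%N ->
  rho a = \sum_(P in NCirr m)
     (-1) ^+ #|P|.-1 * murua K (@nested m) P * \prod_(B in P) kappa (subword a B).
Proof.
move=> m_gt0; have setT0 : [set: 'I_m] != set0.
  by apply/set0Pn; exists (Ordinal m_gt0).
have irr := @nested_irr m; have trans := @nested_trans m.
pose nk (B : {set 'I_m}) := - kappa (subword a B).
pose nr (B : {set 'I_m}) := - rho (subword a B).
pose Y1 := ncp_gf (order_poly K (@nested m)) nk.
pose Y2 := ncp_gf (hook_poly K (@nested m)) nr.
have Y_N1 X : X != set0 -> (Y1 X).[-1] = (Y2 X).[-1].
  move=> X0; rewrite !horner_sum; symmetry.
  transitivity (\sum_(P in ncp X) hook_weight K (@nested m) P *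
                  \prod_(B in P) rho (subword a B)).
    apply: eq_bigr => P _; rewrite hornerZ hook_poly_atN1 prodrN mulrACA.
    by rewrite -signr_odd -expr2 sqrr_sign mul1r mulrC.
  rewrite moment_relation_subset //; apply: eq_bigr => P _.
  rewrite hornerZ (order_poly_atN1 charK irr trans) prodrN mulrAC.
  by rewrite -signr_odd -expr2 sqrr_sign mul1r.
have y1_0 P : (order_poly K (@nested m) P).[0] = (P == set0)%:R := order_poly_at0 charK _ _.
have y2_0 P : (hook_poly K (@nested m) P).[0] = (P == set0)%:R := hook_poly_at0 _ _ _.
have Y1_0 : Y1 set0 = 1.
  by rewrite /Y1 /ncp_gf ncp_set0 big_set1 big_set0 scale1r order_poly_set0.
have Y2_0 : Y2 set0 = 1.
  by rewrite /Y2 /ncp_gf ncp_set0 big_set1 big_set0 scale1r hook_poly_set0.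
have dY1 := deriv_ncp_gf nk (deriv_order_poly_forest charK irr trans).
have dY2 := deriv_ncp_gf nr (deriv_hook_poly charK irr trans).
have := interval_flow_unique charK dY1 dY2 Y1_0 Y2_0 (ncp_gf_at0 nk y1_0)
  (ncp_gf_at0 nr y2_0) Y_N1 setT0.
rewrite nctree_sum_single // /nr subword_setT => /(canLR (@opprK K)) <-.
rewrite NCirr_nctree // /nctree_sum -sumrN; apply: eq_bigr => P PX.
have /tree_neq0 : tree (@nested m) P by move: PX; rewrite inE => /andP[].
rewrite -card_gt0 prodrN; case: #|P| => // c _.
by rewrite exprS mulN1r !mulNr mulrN opprK mulrCA mulrA.
Qed.

End CumulantRelations.

Theorem theorem5p6 (K : fieldType) (charK : [pchar K] =i pred0)
    (A : algType K) (phi : {scalar A}) (phi1 : phi 1 = 1)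
    (rho kappa : seq A -> K)
    (rhoP : monotone_cumulants phi rho) (kappaP : free_cumulants phi kappa) :
  (forall (m : nat) (a : m.-tuple A), (0 < m)%N ->
     rho a = \sum_(P in NCirr m)
               (-1) ^+ #|P|.-1 * ratr (omega P)
                 * \prod_(B in P) kappa (subword a B))
  /\ (forall (m m' : nat) (P : {set {set 'I_m}}) (Q : {set {set 'I_m'}}),
        P \in NCirr m -> Q \in NCirr m' ->
        same_nesting_forest P Q -> omega P = omega Q).
Proof.
split=> [m a m_gt0|m m' P Q PX QX [f [f_inj fP f_covers]]].
  rewrite (monotone_from_free charK rhoP kappaP a m_gt0); apply: eq_bigr => P PX.
  by rewrite ratr_omega //; move: PX; rewrite inE => /andP[].
have NCP : P \in NC m by move: PX; rewrite inE => /andP[].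
have NCQ : Q \in NC m' by move: QX; rewrite inE => /andP[].
rewrite !omegaE // -fP card_in_imset //; apply: eq_bigr => k _.
by rewrite fP (layerings_iso f_inj fP f_covers).
Qed.
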